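(* Let $L$ be a ranked set. Adjoining a strict initial object $0$ to $\mathcal T_L^{\mathrm{sym}}$ gives a category with a noetherian form having exact join decomposition. Its clusters are the marked prunings, allowing an empty marking: clusters over $X$ are cospans $X\xrightarrow{q}Q\xleftarrow{u}U$, up to isomorphism fixing $X$, with $q\in\mathcal E$, $u\in\mathcal M$ and $U$ equal to $0$ or $1$, with the comparisons given in the context. Its universal quotients are prunings followed by isomorphisms, together with $\mathrm{id}_0$ (the class $\mathcal E$); its universal embeddings are occurrences preceded by isomorphisms, together with all maps $0\to X$ (the class $\mathcal M$).
   Context: THE CATEGORY $\mathcal T_L^{\mathrm{sym}}$. A ranked set is a set $L$ with a function $\operatorname{ar}:L\to\mathbb N$. Objects are trees over $L$: the empty leaf $1$ is a tree, and for $\lambda\in L$, $n=\operatorname{ar}(\lambda)$ and trees $T_1,\dots,T_n$ there is a tree $\lambda(T_1,\dots,T_n)$. Positions: $\operatorname{Pos}(1)=\{()\}$, and $\operatorname{Pos}(\lambda(T_1,\dots,T_n))$ consists of the empty word and the words $pb$ with $1\le p\le n$, $b\in\operatorname{Pos}(T_p)$; $X|_a$ is the entire subtree at $a$. An isomorphism of trees preserves labels and empty leaves and may bijectively rearrange children at every labeled vertex: there is one isomorphism $1\to1$, and an isomorphism $\lambda(X_1,\dots,X_n)\to\lambda(Y_1,\dots,Y_n)$ is a permutation $\sigma$ of $\{1,\dots,n\}$ with isomorphisms $X_p\to Y_{\sigma(p)}$; it acts bijectively on positions. An effective cut $K$ of $X$ is a set of positions $a$ with $X|_a\ne1$, none a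 proper prefix of another; $X/K$ is the tree obtained by replacing each $X|_a$, $a\in K$, by $1$. A morphism $X\to Y$ is a triple $(K,p,\theta)$ with $K$ an effective cut of $X$, $p\in\operatorname{Pos}(Y)$, and $\theta:X/K\to Y|_p$ a tree isomorphism. Its positional function $\operatorname{Pos}(X)\to\operatorname{Pos}(Y)$ sends every position having a prefix in $K$ to that prefix and fixes the other positions, then applies $\theta$ on positions, then prefixes $p$. The composite of two morphisms is the unique triple whose positional function is the composite of the positional functions (morphisms with given endpoints are determined by their positional functions); concretely one restricts the second cut to the selected subtree and transports it through $\theta$. The identity is $(\varnothing,(),\mathrm{id})$. Prunings are the triples $(K,(),\mathrm{id}):X\to X/K$; occurrences are the triples $(\varnothing,p,\mathrm{id}):Y|_p\to Y$. AUGMENTATION AND CLUSTERS. Adjoining a strict initial object $0$ means adding an object $0$ with a unique morphism $0\to X$ for every $X$ and no morphism from an old object to $0$. $\mathcal E$: prunings followed by isomorphisms, together with $\mathrm{id}_0$. $\mathcal M$: occurrences preceded by isomorphisms, together with all $0\to X$. For clusters $[q,u]$ over $X$ and $[r,v]$ over $Y$ ($r:Y\to R$, $v:V\to R$) and $f:X\to Y$, $[q,u]\le_f[r,v]$ when there are $h:Q\to R$ and $k:U\to V$ with $hq=rf$ and $hu=vk$. FORMS. A form $\mathsf F$ over a category $\mathcal C$ is a faithful functor to $\mathcal C$, described by its sets $\mathsf F(X)$ of clusters over objects $X$ (fibres) and its comparison relations $L\le_fN$ ($f:X\to Y$, $L\in\mathsf F(X)$, $N\in\mathsf F(Y)$),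 with $L\le_{\mathrm{id}}L$, and $L\le_fM$, $M\le_gN$ implying $L\le_{gf}N$; $\mathsf F(X)$ is ordered by $\le_{\mathrm{id}_X}$, a partial order. It is orean when each fibre is a bounded lattice and every $f:X\to Y$ has functorial direct and inverse images $f_*:\mathsf F(X)\to\mathsf F(Y)$, $f^*:\mathsf F(Y)\to\mathsf F(X)$ with $f_*L\le N\iff L\le_fN\iff L\le f^*N$. Put $\operatorname{Ker}f=f^*(\bot)$, $\operatorname{Im}f=f_*(\top)$. A cluster over $X$ is normal if it is the kernel of a morphism with domain $X$ and conormal if it is the image of a morphism with codomain $X$. A universal quotient of a cluster $L$ over $X$ is $q:X\to Q$ with $L\le\operatorname{Ker}q$ through which every $f:X\to Y$ with $L\le\operatorname{Ker}f$ factors uniquely. A universal embedding of a cluster $N$ over $Y$ is $m:A\to Y$ with $\operatorname{Im}m\le N$ through which every $f:X\to Y$ with $\operatorname{Im}f\le N$ factors uniquely. The universal quotients (embeddings) of the form are the morphisms that are a universal quotient (embedding) of some cluster. An orean form is noetherian when: (1) $f^*f_*L=L\vee\operatorname{Ker}f$ and $f_*f^*N=N\wedge\operatorname{Im}f$ for all $f:X\to Y$, $L\in\mathsf F(X)$, $N\in\mathsf F(Y)$; (2) every morphism factors as a universal quotient of its kernel followed by a universal embedding of its image; (3) binary joins of normal clusters are normal and binary meets of conormal clusters are conormal. It has exact join decomposition if every cluster $L$ has a largest normal cluster $n(L)\le L$ and a largest conormal cluster $c(L)\le L$, and $L=c(L)\vee n(L)$, $f^*n(N)=n(f^*N)$,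 $f_*n(\top)=n(\operatorname{Im}f)$ for all $L$, all $f:X\to Y$ and all $N\in\mathsf F(Y)$. *)

(* Defs.v *)
From mathcomp Require Import all_boot fingroup perm.
From mathcomp Require Import boolp.

Set Implicit Arguments.
Unset Strict Implicit.
Unset Printing Implicit Defensive.

Record rankedSet := RankedSet { label :> Type; ar : label -> nat }.

Inductive tree (L : rankedSet) : Type :=
| leaf : tree L
| node (l : L) (T : 'I_(ar l) -> tree L) : tree L.
Arguments leaf {L}.
Arguments node {L} l T.

(* Positions of a tree as typed words: [root X] is the empty word and
   [child p b] is the word pb; children are numbered from 0. *)
Inductive Pos (L : rankedSet) : tree L -> Type :=
| root X : Pos X
| child l (T : 'I_(ar l) -> tree L) p : Pos (T p) -> Pos (node l T).
Arguments root {L} X.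
Arguments child {L l T} p b.

Definition node_case (L : rankedSet) (l : L) (T : 'I_(ar l) -> tree L)
    (P : Pos (node l T) -> Type) (P0 : P (root _))
    (P1 : forall p b, P (child p b)) (a : Pos (node l T)) : P a :=
  match a as a0 in Pos X0 return
    (match X0 return Pos X0 -> Type with
     | leaf => fun _ => unit
     | node l' T' => fun a' => forall P' : Pos (node l' T') -> Type,
         P' (root _) -> (forall p b, P' (child p b)) -> P' a'
     end) a0
  with
  | root X0 => match X0 with leaf => tt | node l' T' => fun P' H0 _ => H0 end
  | child l' T' p b => fun P' _ H1 => H1 p b
  end P P0 P1.

(* X|_a *)
Fixpoint sub (L : rankedSet) (X : tree L) (a : Pos X) : tree L :=
  match a with root X => X | child _ _ _ b => sub b end.

(* Concatenation of words: the position ab of X, for b a position of X|_a. *)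
Fixpoint pcat (L : rankedSet) (X : tree L) (a : Pos X) : Pos (sub a) -> Pos X :=
  match a as a0 in Pos X0 return Pos (sub a0) -> Pos X0 with
  | root X => fun b => b
  | child _ _ p a' => fun b => child p (@pcat L _ a' b)
  end.
Arguments pcat {L X} a b.

Definition prefix (L : rankedSet) (X : tree L) (a b : Pos X) : Prop :=
  exists c : Pos (sub a), b = pcat a c.

(* Trees have finitely many positions, so sets of positions are given by
   boolean predicates. *)
Record ecut (L : rankedSet) (X : tree L) := ECut {
  cutset :> Pos X -> bool;
  ecut_nonleaf : forall a, cutset a -> sub a <> leaf;
  ecut_antichain : forall a b, cutset a -> cutset b -> prefix a b -> a = b
}.

(* X/K; when K is effective, every element of K is reached by the recursion. *)
Fixpoint prune (L : rankedSet) (X : tree L) : (Pos X -> bool) -> tree L :=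
  match X return (Pos X -> bool) -> tree L with
  | leaf => fun _ => leaf
  | node l T => fun K =>
      if K (root _) then leaf
      else node l (fun p => prune (fun b => K (child p b)))
  end.

(* The map Pos(X) -> Pos(X/K) sending a position with a prefix in K to that
   prefix and fixing the other positions. *)
Fixpoint collapse (L : rankedSet) (X : tree L) (a : Pos X) :
    forall K : Pos X -> bool, Pos (prune K) :=
  match a in Pos X return forall K : Pos X -> bool, Pos (prune K) with
  | root X => fun K => root (prune K)
  | child l T p b => fun K =>
      match K (root _) as k return
        Pos (if k then leaf else node l (fun p => prune (fun b => K (child p b))))
      with
      | true => root leaf
      | false => child p (collapse b (fun b => K (child p b)))
      end
  end.

Inductive iso (L : rankedSet) : tree L -> tree L -> Type :=
| iso_leaf : iso leaf leaf
| iso_node l (X Y : 'I_(ar l) -> tree L) (s : {perm 'I_(ar l)}) :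
    (forall p, iso (X p) (Y (s p))) -> iso (node l X) (node l Y).
Arguments iso_leaf {L}.
Arguments iso_node {L l X Y} s t.

Fixpoint iso_pos (L : rankedSet) (X Y : tree L) (t : iso X Y) : Pos X -> Pos Y :=
  match t with
  | iso_leaf => fun a => a
  | iso_node l X Y s t => fun a =>
      node_case (P := fun _ => Pos (node l Y)) (root _)
        (fun p b => child (s p) (iso_pos (t p) b)) a
  end.

Fixpoint iso_id (L : rankedSet) (X : tree L) : iso X X :=
  match X with
  | leaf => iso_leaf
  | node l T => iso_node 1%g (fun p =>
      eq_rect p (fun q => iso (T p) (T q)) (iso_id (T p)) _ (esym (perm1 p)))
  end.

(* The identity isomorphism between equal trees. *)
Definition iso_eq (L : rankedSet) (X Y : tree L) (e : X = Y) : iso X Y :=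
  eq_rect X (iso X) (iso_id X) Y e.

Record mor (L : rankedSet) (X Y : tree L) := Mor {
  mcut : ecut X;
  mpos : Pos Y;
  miso : iso (prune mcut) (sub mpos)
}.

Definition posfun (L : rankedSet) (X Y : tree L) (f : mor X Y) (a : Pos X) : Pos Y :=
  pcat (mpos f) (iso_pos (miso f) (collapse a (mcut f))).

Definition ecut0 (L : rankedSet) (X : tree L) : ecut X.
Proof. by exists (fun _ => false). Defined.

Lemma prune0 (L : rankedSet) (X : tree L) : prune (ecut0 X) = X.
Proof.
elim: X => [//|l T IH] /=; congr node; apply: funext => p; exact: IH.
Qed.

Definition mor_id (L : rankedSet) (X : tree L) : mor X X :=
  @Mor L X X (ecut0 X) (root X) (iso_eq (prune0 X)).

Definition pruning (L : rankedSet) (X : tree L) (K : ecut X) : mor X (prune K) :=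
  @Mor L X (prune K) K (root _) (iso_id _).

Definition occurrence (L : rankedSet) (Y : tree L) (p : Pos Y) : mor (sub p) Y :=
  @Mor L (sub p) Y (ecut0 _) p (iso_eq (prune0 _)).

Lemma node_inj (L : rankedSet) (l : L) (T T' : 'I_(ar l) -> tree L) :
  node l T = node l T' -> T = T'.
Proof.
move=> e.
have aux Z : node l T = Z ->
    match Z with
    | leaf => True
    | node l' T2 => forall e' : l = l',
        eq_rect l (fun k => 'I_(ar k) -> tree L) T l' e' = T2
    end.
  by move=> e0; case: _ / e0 => e'; rewrite (Prop_irrelevance e' erefl).
exact: (aux _ e erefl).
Qed.

Lemma Pos_leaf (L : rankedSet) (a : Pos (@leaf L)) : a = root leaf.
Proof.
refine (match a as a0 in Pos X0 return
    match X0 return Pos X0 -> Prop with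
    | leaf => fun a1 => a1 = root leaf | node _ _ => fun _ => True end a0
  with root X0 => _ | child _ _ _ _ => I end).
by case: X0.
Qed.

Lemma child_inj (L : rankedSet) (l : L) (T : 'I_(ar l) -> tree L) p q
    (b : Pos (T p)) (c : Pos (T q)) :
  child p b = child q c -> existT (fun p => Pos (T p)) p b = existT _ q c.
Proof.
move=> e; pose un (a : Pos (node l T)) := node_case (P := fun _ => option _) None
  (fun p b => Some (existT (fun p => Pos (T p)) p b)) a.
by have := congr1 un e; case.
Qed.

Lemma child_inj1 (L : rankedSet) (l : L) (T : 'I_(ar l) -> tree L) p q
    (b : Pos (T p)) (c : Pos (T q)) : child p b = child q c -> p = q.
Proof. by move=> e; exact: (f_equal (@projT1 _ _) (child_inj e)). Qed.

Lemma existT_inj (A : Type) (P : A -> Type) x (b c : P x) :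
  existT P x b = existT P x c -> b = c.
Proof.
move=> e.
have aux u : existT P x b = u ->
    forall e : x = projT1 u, eq_rect x P b _ e = projT2 u.
  by move=> e0; case: _ / e0 => e'; rewrite (Prop_irrelevance e' erefl).
exact: (aux _ e erefl).
Qed.

Lemma child_inj2 (L : rankedSet) (l : L) (T : 'I_(ar l) -> tree L) p
    (b c : Pos (T p)) : child p b = child p c -> b = c.
Proof. by move=> e; exact: existT_inj (child_inj e). Qed.

Lemma root_child (L : rankedSet) (l : L) (T : 'I_(ar l) -> tree L) p
    (b : Pos (T p)) : root _ <> child p b.
Proof.
move=> e; pose f (a : Pos (node l T)) :=
  node_case (P := fun _ => bool) true (fun _ _ => false) a.
by have := congr1 f e.
Qed.

Lemma pcat_inj (L : rankedSet) (X : tree L) (a : Pos X) : injective (pcat a).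
Proof.
elim: a => [X0|l T p a IH] b c //= e; exact: IH (child_inj2 e).
Qed.

Lemma iso_nodeP (L : rankedSet) (l : L) (X : 'I_(ar l) -> tree L)
    (P : forall Z, iso (node l X) Z -> Prop) :
  (forall Y s t, P (node l Y) (iso_node s t)) -> forall Z u, P Z u.
Proof.
move=> H Z u; move: P H.
refine (match u as u0 in iso A Z0 return
    match A return iso A Z0 -> Prop with
    | leaf => fun _ => True
    | node l' X' => fun u1 => forall P : forall Z, iso (node l' X') Z -> Prop,
        (forall Y s t, P (node l' Y) (iso_node s t)) -> P Z0 u1
    end u0
  with iso_leaf => I | iso_node _ _ _ _ _ => _ end).
by move=> P; apply.
Qed.

Lemma iso_leafP (L : rankedSet) (P : forall Z : tree L, iso leaf Z -> Prop) :
  P leaf iso_leaf -> forall Z u, P Z u.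
Proof.
move=> H Z u; move: P H.
refine (match u as u0 in iso A Z0 return
    match A return iso A Z0 -> Prop with
    | leaf => fun u1 => forall P : forall Z, iso leaf Z -> Prop,
        P leaf iso_leaf -> P Z0 u1
    | node l' X' => fun _ => True
    end u0
  with iso_leaf => _ | iso_node _ _ _ _ _ => I end).
by move=> P; apply.
Qed.

Lemma iso_pos_root (L : rankedSet) (X Y : tree L) (t : iso X Y) :
  iso_pos t (root X) = root Y.
Proof. by case: t. Qed.

Lemma iso_pos_id (L : rankedSet) (X : tree L) (a : Pos X) : iso_pos (iso_id X) a = a.
Proof.
elim: X a => [//|l T IH] a /=.
elim/node_case: a => [//|p b] /=.
by case: _ / (esym (perm1 p)) => /=; rewrite IH.
Qed.

Lemma iso_node1 (L : rankedSet) (l : L) (X Y : 'I_(ar l) -> tree L)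
    (t : forall p, iso (X p) (Y p)) :
  exists u : iso (node l X) (node l Y),
    forall p b, iso_pos u (child p b) = child p (iso_pos (t p) b).
Proof.
exists (iso_node 1%g (fun p =>
  eq_rect p (fun q => iso (X p) (Y q)) (t p) _ (esym (perm1 p)))) => p b /=.
by case: _ / (esym (perm1 p)).
Qed.

Lemma iso_comp (L : rankedSet) (X Y Z : tree L) (t : iso X Y) (u : iso Y Z) :
  exists v : iso X Z, forall a, iso_pos v a = iso_pos u (iso_pos t a).
Proof.
elim: t Z u => [|l X' Y' s t IH] Z; first by move=> u; exists u.
elim/iso_nodeP=> Z' s' t'.
pose v p := cid (IH p _ (t' (s p))).
have H p : s' (s p) = (s * s')%g p by rewrite permM.
exists (iso_node (s * s')%g (fun p =>
  eq_rect _ (fun q => iso (X' p) (Z' q)) (projT1 (v p)) _ (H p))) => a.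
elim/node_case: a => [//|p b] /=.
case: _ / (H p) => /=; by rewrite (projT2 (v p)).
Qed.

Fixpoint eff (L : rankedSet) (X : tree L) : (Pos X -> bool) -> Prop :=
  match X return (Pos X -> bool) -> Prop with
  | leaf => fun K => K (root _) = false
  | node l T => fun K =>
      if K (root _) then forall p b, K (child p b) = false
      else forall p, eff (fun b => K (child p b))
  end.

Lemma effP (L : rankedSet) (X : tree L) (K : Pos X -> bool) :
  eff K <-> (forall a, K a -> sub a <> leaf) /\
            (forall a b, K a -> K b -> prefix a b -> a = b).
Proof.
split.
- elim: X K => [|l T IH] K /=.
    by move=> K0; split=> a; rewrite (Pos_leaf a) K0.
  case K0: (K _) => HK; split=> a.
  + by elim/node_case: a => [|p b]; rewrite ?HK.
  + elim/node_case: a => [|p b] c; last by rewrite HK.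
    by elim/node_case: c => [|q c]; rewrite ?HK.
  + elim/node_case: a => [|p b]; first by rewrite K0.
    by apply: (proj1 (IH p _ (HK p))).
  + elim/node_case: a => [|p b] c; first by rewrite K0.
    elim/node_case: c => [|q c]; first by rewrite K0.
    move=> Kb Kc [d] /= e; move: (child_inj1 e) => epq.
    subst q; move: (child_inj2 e) => e'.
    by congr child; apply: (proj2 (IH p _ (HK p))) => //; exists d.
- elim: X K => [|l T IH] K /= [H1 H2].
    by case K0: (K _) => //; have := H1 _ K0.
  case K0: (K _) => p.
    move=> b; case Kb: (K _) => //; have := H2 _ _ K0 Kb.
    by move=> /(_ (ex_intro _ (child p b) erefl)) /root_child.
  apply: IH; split=> [a /H1 //|a b Ka Kb [c e]].
  by apply: (@child_inj2 L l T p); apply: H2 => //; exists c; rewrite e.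
Qed.

Lemma ecut_eff (L : rankedSet) (X : tree L) (K : ecut X) : eff K.
Proof. by apply/effP; case: K. Qed.

(* The empty leaf has no effective cut at its root, hence the case split. *)
Definition topcut (L : rankedSet) (X : tree L) : Pos X -> bool :=
  match X return Pos X -> bool with
  | leaf => fun _ => false
  | node l T => fun a => node_case (P := fun _ => bool) true (fun _ _ => false) a
  end.

Lemma eff_top (L : rankedSet) (X : tree L) : eff (@topcut L X).
Proof. by case: X. Qed.

Lemma prune_top (L : rankedSet) (X : tree L) : prune (@topcut L X) = leaf.
Proof. by case: X. Qed.

Lemma Pos_leaf2 (L : rankedSet) (X : tree L) (a b : Pos X) : X = leaf -> a = b.
Proof.
by move=> e; move: a b; rewrite e => a b; rewrite (Pos_leaf a) (Pos_leaf b).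
Qed.

Lemma occ_occ (L : rankedSet) (Y : tree L) (p : Pos Y) (q : Pos (sub p)) :
  exists t : iso (sub q) (sub (pcat p q)),
    forall b, pcat p (pcat q b) = pcat (pcat p q) (iso_pos t b).
Proof.
elim: p q => [X q|l T p a IH q] /=.
  by exists (iso_id _) => b; rewrite iso_pos_id.
by have [t H] := IH q; exists t => b; rewrite H.
Qed.

Lemma occ_iso (L : rankedSet) (Y Z : tree L) (t : iso Y Z) (p : Pos Y) :
  exists (q : Pos Z) (u : iso (sub p) (sub q)),
    forall b, iso_pos t (pcat p b) = pcat q (iso_pos u b).
Proof.
elim: p Z t => [X Z t|l T p a IH Z].
  by exists (root _), t.
elim/iso_nodeP=> Z' s t /=; have [q [u H]] := IH _ (t p).
by exists (child (s p) q), u => b; rewrite H.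
Qed.

Lemma occ_prune (L : rankedSet) (Y : tree L) (K : Pos Y -> bool) (p : Pos Y) :
  eff K -> exists (J : Pos (sub p) -> bool) (q : Pos (prune K))
      (u : iso (prune J) (sub q)),
    eff J /\ forall b, collapse (pcat p b) K = pcat q (iso_pos u (collapse b J)).
Proof.
elim: p K => [X K HK|l T p a IH K] /=.
  by exists K, (root _), (iso_id _); split=> // b; rewrite iso_pos_id.
case: (K _) => HK.
  exists (@topcut _ _), (root _), (iso_eq (prune_top _)).
  by split=> [|b]; [exact: eff_top|exact: Pos_leaf2].
have [J [q [u [HJ H]]]] := IH _ (HK p).
by exists J, (child p q), u; split=> // b; rewrite H.
Qed.

Definition coll_node (L : rankedSet) (l : L) (T : 'I_(ar l) -> tree L)
    (K : Pos (node l T) -> bool) (k : bool) (a : Pos (node l T)) :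
    Pos (if k then leaf else node l (fun p => prune (fun b => K (child p b)))) :=
  node_case (P := fun _ => Pos _) (root _) (fun p b =>
    match k return
      Pos (if k then leaf else node l (fun p => prune (fun b => K (child p b))))
    with true => root _ | false => child p (collapse b _) end) a.

Lemma collapseE (L : rankedSet) (l : L) (T : 'I_(ar l) -> tree L)
    (K : Pos (node l T) -> bool) a : collapse a K = coll_node K (K (root _)) a.
Proof. by elim/node_case: a. Qed.

Lemma iso_prune (L : rankedSet) (X Y : tree L) (t : iso X Y) (K : Pos Y -> bool) :
  eff K -> exists (J : Pos X -> bool) (u : iso (prune J) (prune K)),
    eff J /\ forall a, collapse (iso_pos t a) K = iso_pos u (collapse a J).
Proof.
elim: t K => [|l X' Y' s t IH] K HK.
  exists K, (iso_id _); split=> // a; by rewrite iso_pos_id.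
suff: exists J (u : iso (prune J) (prune K)), eff J /\
    forall a, coll_node K (K (root _)) (iso_pos (iso_node s t) a) =
              iso_pos u (collapse a J).
  move=> [J [u [HJ H]]]; exists J, u; split=> // a; by rewrite collapseE H.
move: HK => /=; case: (K _) => HK.
  exists (@topcut L (node l X')), iso_leaf; split=> [//|a]; exact: Pos_leaf2.
pose c p := cid (IH p _ (HK (s p))); pose d p := cid (projT2 (c p)).
exists (fun a => node_case (P := fun _ => bool) false (fun p => projT1 (c p)) a).
exists (iso_node s (fun p => projT1 (d p))); split=> [p|a] /=.
  exact: (proj1 (projT2 (d p))).
elim/node_case: a => [//|p b] /=.
congr child; exact: (proj2 (projT2 (d p))).
Qed.

Lemma prune_prune (L : rankedSet) (X : tree L) (K : Pos X -> bool)
    (K' : Pos (prune K) -> bool) :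
  eff K -> eff K' -> exists (J : Pos X -> bool) (u : iso (prune J) (prune K')),
    eff J /\ forall a, collapse (collapse a K) K' = iso_pos u (collapse a J).
Proof.
elim: X K K' => [|l T IH] K K' HK HK'.
  exists K, (iso_id _); split=> // a; rewrite iso_pos_id; exact: Pos_leaf2.
suff: exists J (u : iso (prune J) (prune K')), eff J /\
    forall a, collapse (coll_node K (K (root _)) a) K' = iso_pos u (collapse a J).
  move=> [J [u [HJ H]]]; exists J, u; split=> // a; by rewrite collapseE H.
move: HK K' HK' => /=; case: (K _) => HK K' HK'.
  exists (@topcut L (node l T)), iso_leaf; split=> [//|a]; exact: Pos_leaf2.
suff: exists J (u : iso (prune J) (prune K')), eff J /\
    forall a, coll_node K' (K' (root _)) (coll_node K false a)
              = iso_pos u (collapse a J).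
  move=> [J [u [HJ H]]]; exists J, u; split=> // a; by rewrite collapseE H.
move: HK' => /=; case: (K' _) => HK'.
  exists (@topcut L (node l T)), iso_leaf; split=> [//|a]; exact: Pos_leaf2.
pose c p := cid (IH p _ _ (HK p) (HK' p)); pose d p := cid (projT2 (c p)).
have [u Hu] := iso_node1 (fun p => projT1 (d p)).
exists (fun a => node_case (P := fun _ => bool) false (fun p => projT1 (c p)) a), u.
split=> [p|a]; first exact: (proj1 (projT2 (d p))).
elim/node_case: a => [|p b]; first by rewrite iso_pos_root.
by rewrite Hu /= -(proj2 (projT2 (d p))).
Qed.

Lemma mor_of (L : rankedSet) (X Y : tree L) (J : Pos X -> bool) (p : Pos Y)
    (t : iso (prune J) (sub p)) :
  eff J -> exists h : mor X Y,
    forall a, posfun h a = pcat p (iso_pos t (collapse a J)).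
Proof.
by move=> /effP [H1 H2]; exists (@Mor L X Y (ECut H1 H2) p t).
Qed.

Lemma posfun_comp_ex (L : rankedSet) (X Y Z : tree L) (g : mor Y Z) (f : mor X Y) :
  exists h : mor X Z, forall a, posfun h a = posfun g (posfun f a).
Proof.
case: f => K1 p1 t1; case: g => K2 p2 t2; rewrite /posfun /=.
have [K3 [p3 [t3 [e3 E3]]]] := occ_prune p1 (ecut_eff K2).
have [K4 [t4 [e4 E4]]] := iso_prune t1 e3.
have [K5 [t5 [e5 E5]]] := prune_prune (ecut_eff K1) e4.
have [p6 [t6 E6]] := occ_iso t2 p3.
have [t7 E7] := occ_occ p6.
have [u1 U1] := iso_comp t5 t4; have [u2 U2] := iso_comp u1 t3.
have [u3 U3] := iso_comp u2 t6; have [u4 U4] := iso_comp u3 t7.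
have [h H] := mor_of u4 e5; exists h => a.
apply: etrans (H a) _; by rewrite U4 U3 U2 U1 E3 E4 E5 E6 E7.
Qed.

Lemma iso_inj (L : rankedSet) (X Y : tree L) (t u : iso X Y) :
  iso_pos t =1 iso_pos u -> t = u.
Proof.
elim: t u => [|l X' Y' s t IH] u.
  suff: forall Z (u : iso (@leaf L) Z) (e : Z = leaf),
      eq_rect _ (iso leaf) u _ e = iso_leaf.
    by move=> H _; rewrite -(H _ u erefl).
  move=> Z; elim/iso_leafP=> e; by rewrite (Prop_irrelevance e erefl).
suff: forall Z (u : iso (node l X') Z) (e : Z = node l Y'),
    iso_pos (iso_node s t) =1 iso_pos (eq_rect _ (iso (node l X')) u _ e) ->
    iso_node s t = eq_rect _ (iso (node l X')) u _ e.
  by move=> H; exact: (H _ u erefl).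
move=> Z; elim/iso_nodeP=> Y2 s' t' e.
move: (node_inj e) => e'; subst Y2; rewrite (Prop_irrelevance e erefl) /= => H.
have Es : s = s'.
  apply/permP=> p; exact: child_inj1 (H (child p (root _))).
subst s'; congr iso_node; apply: functional_extensionality_dep => p.
apply: IH => b; exact: child_inj2 (H (child p b)).
Qed.

Lemma cut_inj (L : rankedSet) (X W : tree L) (K J : Pos X -> bool)
    (t : iso (prune K) W) (u : iso (prune J) W) :
  eff K -> eff J ->
  (forall a, iso_pos t (collapse a K) = iso_pos u (collapse a J)) -> K =1 J.
Proof.
elim: X W K J t u => [|l T IH] W K J t u.
  by move=> HK HJ _ a; rewrite (Pos_leaf a) HK HJ.
move=> HK HJ H.
have {}H a : iso_pos t (coll_node K (K (root _)) a) =
             iso_pos u (coll_node J (J (root _)) a) by rewrite -!collapseE H.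
have iso_ln m (S : 'I_(ar m) -> tree L) V :
    iso leaf V -> iso (node m S) V -> False.
  move=> v; elim/iso_leafP: v => v.
  pose P Z (_ : iso (node m S) Z) := Z <> leaf.
  by have: P _ v by elim/iso_nodeP: v.
have: K (root _) = J (root _) /\ forall p, K \o child p =1 J \o child p.
  move: HK HJ t u H => /=.
  case: (K _); case: (J _) => HK HJ t u H.
  - by split=> // p b /=; rewrite HK HJ.
  - by case: (iso_ln _ _ _ t u).
  - by case: (iso_ln _ _ _ u t).
  split=> // p; move: t u H.
  move=> t; elim/iso_nodeP: t => Y s t u.
  pose Q Z (u : iso (node l (fun p => prune (fun b => J (child p b)))) Z) :=
    forall e : Z = node l Y,
    (forall a, iso_pos (iso_node s t) (coll_node K false a) =
      eq_rect _ (@Pos L) (iso_pos u (coll_node J false a)) _ e) ->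
    K \o child p =1 J \o child p.
  suff: Q _ u by move=> /(_ erefl).
  elim/iso_nodeP: u => Y2 s' t' e.
  move: (node_inj e) => e'; subst Y2; rewrite (Prop_irrelevance e erefl) /= => H.
  have Ep : s p = s' p.
    exact: child_inj1 (H (child p (root _))).
  have /= := fun b => H (child p b).
  move: (t' p); rewrite -Ep => v Hv.
  apply: (IH p _ _ _ (t p) v (HK p) (HJ p)) => b.
  exact: child_inj2 (Hv b).
by case=> H0 H1; elim/node_case=> [//|p b]; exact: H1.
Qed.

Lemma collapse_surj (L : rankedSet) (X : tree L) (K : Pos X -> bool) (c : Pos (prune K)) :
  exists a, collapse a K = c.
Proof.
elim: X K c => [|l T IH] K c.
  by exists (root _); apply: Pos_leaf2.
suff: exists a, coll_node K (K (root _)) a = c.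
  by move=> [a <-]; exists a; rewrite collapseE.
move: c => /=; case: (K _) => c.
  by exists (root _); apply: Pos_leaf2.
elim/node_case: c => [|p c]; first by exists (root _).
by have [a <-] := IH _ _ c; exists (child p a).
Qed.

Lemma posfun_inj (L : rankedSet) (X Y : tree L) (f g : mor X Y) :
  posfun f =1 posfun g -> f = g.
Proof.
case: f => K p t; case: g => J q u H.
have pcat_root (Z : tree L) (a : Pos Z) : pcat a (root _) = a.
  by elim: a => //= l T r a ->.
have Epq : p = q.
  have := H (root _); by rewrite /posfun /= !iso_pos_root !pcat_root.
subst q; have {}H a : iso_pos t (collapse a K) = iso_pos u (collapse a J).
  exact: pcat_inj (H a).
have EK : K = J.
  have := cut_inj (ecut_eff K) (ecut_eff J) H => /funext.
  case: K J {t u H} => K k1 k2 [J j1 j2] /= E; subst J.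
  by rewrite (Prop_irrelevance k1 j1) (Prop_irrelevance k2 j2).
subst J; congr Mor; apply: iso_inj => c.
by have [a <-] := collapse_surj c; exact: H.
Qed.

Record category := Category {
  obj :> Type;
  hom : obj -> obj -> Type;
  idm : forall X, hom X X;
  comp : forall X Y Z, hom Y Z -> hom X Y -> hom X Z;
  comp_idl : forall X Y (f : hom X Y), comp (idm Y) f = f;
  comp_idr : forall X Y (f : hom X Y), comp f (idm X) = f;
  comp_assoc : forall W X Y Z (h : hom Y Z) (g : hom X Y) (f : hom W X),
    comp h (comp g f) = comp (comp h g) f
}.
Arguments hom {c} X Y.
Arguments idm {c} X.
Arguments comp {c X Y Z} g f.

Definition is_iso (C : category) (X Y : C) (f : hom X Y) : Prop :=
  exists g : hom Y X, comp g f = idm X /\ comp f g = idm Y.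

(* The composite is the unique morphism (see [posfun_inj]) whose positional
   function is the composite of the positional functions. *)
Definition mor_comp (L : rankedSet) (X Y Z : tree L) (g : mor Y Z) (f : mor X Y) :
    mor X Z := projT1 (cid (posfun_comp_ex g f)).

Lemma posfun_comp (L : rankedSet) (X Y Z : tree L) (g : mor Y Z) (f : mor X Y) a :
  posfun (mor_comp g f) a = posfun g (posfun f a).
Proof. exact: (projT2 (cid (posfun_comp_ex g f))). Qed.

Lemma prune0_collapse (L : rankedSet) (X : tree L) a :
  iso_pos (iso_eq (prune0 X)) (collapse a (ecut0 X)) = a.
Proof.
have iso_eqE Y Z (e : Y = Z) (b : Pos Y) :
    iso_pos (iso_eq e) b = eq_rect Y (@Pos L) b Z e.
  by subst Z; rewrite /= iso_pos_id.
rewrite iso_eqE; elim: a (prune0 X) => {X} [X|l T p b IH] /= e.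
  suff: forall Y (e : prune (fun _ : Pos X => false) = Y),
    eq_rect _ (@Pos L) (root _) Y e = root Y by apply.
  by move=> Y {}e; subst Y.
have aux (T1 T2 : 'I_(ar l) -> tree L) (e1 : node l T1 = node l T2)
    (ep : T1 p = T2 p) (x : Pos (T1 p)) :
    eq_rect _ (@Pos L) (child p x) _ e1 = child p (eq_rect _ (@Pos L) x _ ep).
  move: (node_inj e1) => e'; subst T2.
  by rewrite (Prop_irrelevance e1 erefl) (Prop_irrelevance ep erefl).
have ep : prune (fun _ : Pos (T p) => false) = T p.
  exact: (f_equal (fun T' => T' p) (node_inj e)).
by rewrite (aux _ _ e ep) IH.
Qed.

Lemma posfun_id (L : rankedSet) (X : tree L) a : posfun (mor_id X) a = a.
Proof. exact: prune0_collapse. Qed.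

Lemma posfun_pruning (L : rankedSet) (X : tree L) (K : ecut X) a :
  posfun (pruning K) a = collapse a K.
Proof. exact: iso_pos_id. Qed.

Lemma posfun_occurrence (L : rankedSet) (Y : tree L) (p : Pos Y) b :
  posfun (occurrence p) b = pcat p b.
Proof. by rewrite /posfun /= prune0_collapse. Qed.

Definition treeCat (L : rankedSet) : category.
Proof.
refine (@Category (tree L) (@mor L) (@mor_id L) (@mor_comp L) _ _ _).
- by move=> X Y f; apply: posfun_inj => a; rewrite posfun_comp posfun_id.
- by move=> X Y f; apply: posfun_inj => a; rewrite posfun_comp posfun_id.
- by move=> W X Y Z h g f; apply: posfun_inj => a; rewrite !posfun_comp.
Defined.

(* [None] is the adjoined strict initial object: nothing but [None] maps to it. *)
Definition hom0 (C : category) (X Y : option C) : Type :=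
  match X, Y with
  | None, _ => unit
  | Some _, None => Empty_set
  | Some X, Some Y => hom X Y
  end.

Definition idm0 (C : category) (X : option C) : hom0 X X :=
  match X with None => tt | Some X => idm X end.

Definition comp0 (C : category) (X Y Z : option C) :
    hom0 Y Z -> hom0 X Y -> hom0 X Z :=
  match X, Y, Z return hom0 Y Z -> hom0 X Y -> hom0 X Z with
  | None, _, _ => fun _ _ => tt
  | Some _, None, _ => fun _ f => match f with end
  | Some _, Some _, None => fun g _ => g
  | Some _, Some _, Some _ => fun g f => comp g f
  end.

Definition adjoin0 (C : category) : category.
Proof.
refine (@Category (option C) (@hom0 C) (@idm0 C) (@comp0 C) _ _ _).
- by move=> [X|] [Y|] /= f; [exact: comp_idl|case: f|case: f|case: f].
- by move=> [X|] [Y|] /= f; [exact: comp_idr|case: f|case: f|case: f].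
- by move=> [W|] [X|] [Y|] [Z|] //= h g f; exact: comp_assoc.
Defined.

Definition augCat (L : rankedSet) : category := adjoin0 (treeCat L).
Definition zero (L : rankedSet) : augCat L := None.
Definition one (L : rankedSet) : augCat L := Some (@leaf L).
Arguments zero {L}.
Arguments one {L}.

Definition from0 (L : rankedSet) (X : augCat L) : hom zero X := tt.

Definition augPruning (L : rankedSet) (X : tree L) (K : ecut X) :
  hom (Some X : augCat L) (Some (prune K) : augCat L) := pruning K.

Definition augOccurrence (L : rankedSet) (Y : tree L) (p : Pos Y) :
  hom (Some (sub p) : augCat L) (Some Y : augCat L) := occurrence p.

Inductive classE (L : rankedSet) : forall X Y : augCat L, hom X Y -> Prop :=
| classE_pruning (X Y : tree L) (K : ecut X)
    (i : hom (Some (prune K) : augCat L) (Some Y : augCat L)) :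
    is_iso i -> classE (comp i (augPruning K))
| classE_id0 : classE (idm zero).

Inductive classM (L : rankedSet) : forall X Y : augCat L, hom X Y -> Prop :=
| classM_occurrence (X Y : tree L) (p : Pos Y)
    (i : hom (Some X : augCat L) (Some (sub p) : augCat L)) :
    is_iso i -> classM (comp (augOccurrence p) i)
| classM_from0 (X : augCat L) : classM (from0 X).

Record cospan (L : rankedSet) (X : augCat L) := Cospan {
  cobj : augCat L;
  cquo : hom X cobj;
  mobj : augCat L;
  cmark : hom mobj cobj;
  cquoE : classE cquo;
  cmarkM : classM cmark;
  mobj01 : mobj = zero \/ mobj = one
}.

Definition cospan_iso (L : rankedSet) (X : augCat L) (c d : cospan X) : Prop :=
  exists (h : hom (cobj c) (cobj d)) (k : hom (mobj c) (mobj d)),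
    [/\ is_iso h, is_iso k, comp h (cquo c) = cquo d
      & comp h (cmark c) = comp (cmark d) k].

Definition cospan_le (L : rankedSet) (X Y : augCat L) (f : hom X Y)
    (c : cospan X) (d : cospan Y) : Prop :=
  exists (h : hom (cobj c) (cobj d)) (k : hom (mobj c) (mobj d)),
    comp h (cquo c) = comp (cquo d) f /\ comp h (cmark c) = comp (cmark d) k.

(* An isomorphism class is represented by its set of members, so isomorphic
   cospans give equal clusters; by [cluster_leE] below, [cluster_le] does not
   depend on the chosen representatives. *)
Definition cluster (L : rankedSet) (X : augCat L) : Type :=
  {A : cospan X -> Prop | exists c, A = cospan_iso c}.

Definition cluster_of (L : rankedSet) (X : augCat L) (c : cospan X) : cluster X :=
  exist _ (cospan_iso c) (ex_intro _ c erefl).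

Definition cluster_le (L : rankedSet) (X Y : augCat L) (f : hom X Y)
    (A : cluster X) (B : cluster Y) : Prop :=
  exists c d, [/\ sval A c, sval B d & cospan_le f c d].

Lemma is_iso_id (C : category) (X : C) : is_iso (idm X).
Proof. by exists (idm X); rewrite comp_idl. Qed.

Lemma cospan_iso_refl (L : rankedSet) (X : augCat L) (c : cospan X) : cospan_iso c c.
Proof.
by exists (idm _), (idm _); split; rewrite ?comp_idl ?comp_idr //; exact: is_iso_id.
Qed.

Lemma cluster_leE (L : rankedSet) (X Y : augCat L) (f : hom X Y)
    (c : cospan X) (d : cospan Y) :
  cluster_le f (cluster_of c) (cluster_of d) <-> cospan_le f c d.
Proof.
split=> [[c' [d' [/= cc dd [h [k [h1 h2]]]]]]|]; last first.
  by move=> H; exists c, d; split=> //; exact: cospan_iso_refl.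
have [i [j [_ _ i1 i2]]] := cc.
have [h0 [j' [[p [p1 _]] [r [_ r2]] i1' i2']]] := dd.
exists (comp p (comp h i)), (comp r (comp k j)); split.
  by rewrite -!comp_assoc i1 h1 -i1' !comp_assoc p1 comp_idl.
have e : comp p (cmark d') = comp (cmark d) r.
  have i2r : comp (comp p (comp h0 (cmark d))) r = comp (comp p (comp (cmark d') j')) r.
    by rewrite i2'.
  move: i2r; rewrite -!comp_assoc r2 comp_idr => <-.
  by rewrite (comp_assoc p h0) p1 comp_idl.
by rewrite -!comp_assoc i2 (comp_assoc h) h2 -(comp_assoc (cmark d')) (comp_assoc p) e
  -!comp_assoc.
Qed.

(* A faithful functor to C, described by its fibres and comparison relations;
   the laws are stated separately in [is_form]. *)
Record formData (C : category) := FormData {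
  fib : C -> Type;
  cmp : forall X Y, hom X Y -> fib X -> fib Y -> Prop
}.
Arguments fib {C} f X.
Arguments cmp {C f X Y} _ _ _.

Definition fle (C : category) (F : formData C) (X : C) (A B : fib F X) : Prop :=
  cmp (idm X) A B.

Definition is_form (C : category) (F : formData C) : Prop :=
  [/\ forall X (A : fib F X), fle A A,
      forall X Y Z (f : hom X Y) (g : hom Y Z) (A : fib F X) (B : fib F Y)
        (D : fib F Z), cmp f A B -> cmp g B D -> cmp (comp g f) A D
    & forall X (A B : fib F X), fle A B -> fle B A -> A = B].

Record orean (C : category) (F : formData C) := Orean {
  bot : forall X, fib F X;
  top : forall X, fib F X;
  join : forall X, fib F X -> fib F X -> fib F X;
  meet : forall X, fib F X -> fib F X -> fib F X;
  dir : forall X Y, hom X Y -> fib F X -> fib F Y;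
  inv : forall X Y, hom X Y -> fib F Y -> fib F X;
  bot_le : forall X (A : fib F X), fle (bot X) A;
  le_top : forall X (A : fib F X), fle A (top X);
  join_le : forall X (A B D : fib F X), fle (join A B) D <-> fle A D /\ fle B D;
  le_meet : forall X (A B D : fib F X), fle D (meet A B) <-> fle D A /\ fle D B;
  dir_le : forall X Y (f : hom X Y) A B, fle (dir f A) B <-> cmp f A B;
  le_inv : forall X Y (f : hom X Y) A B, cmp f A B <-> fle A (inv f B);
  dir_id : forall X A, dir (idm X) A = A;
  dir_comp : forall X Y Z (g : hom Y Z) (f : hom X Y) A,
    dir (comp g f) A = dir g (dir f A);
  inv_id : forall X A, inv (idm X) A = A;
  inv_comp : forall X Y Z (g : hom Y Z) (f : hom X Y) A,
    inv (comp g f) A = inv f (inv g A)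
}.

Definition Ker (C : category) (F : formData C) (O : orean F) (X Y : C)
  (f : hom X Y) : fib F X := inv O f (bot O Y).

Definition Im (C : category) (F : formData C) (O : orean F) (X Y : C)
  (f : hom X Y) : fib F Y := dir O f (top O X).

Definition normal (C : category) (F : formData C) (O : orean F) (X : C)
  (A : fib F X) : Prop := exists (Y : C) (f : hom X Y), A = Ker O f.

Definition conormal (C : category) (F : formData C) (O : orean F) (X : C)
  (A : fib F X) : Prop := exists (W : C) (f : hom W X), A = Im O f.

Definition univ_quotient_of (C : category) (F : formData C) (O : orean F) (X Q : C)
    (A : fib F X) (q : hom X Q) : Prop :=
  fle A (Ker O q) /\
  forall (Y : C) (f : hom X Y), fle A (Ker O f) ->
    exists! g : hom Q Y, comp g q = f.

Definition univ_embedding_of (C : category) (F : formData C) (O : orean F) (W Y : C)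
    (B : fib F Y) (m : hom W Y) : Prop :=
  fle (Im O m) B /\
  forall (X : C) (f : hom X Y), fle (Im O f) B ->
    exists! g : hom X W, comp m g = f.

Definition univ_quotient (C : category) (F : formData C) (O : orean F) (X Q : C)
  (q : hom X Q) : Prop := exists A : fib F X, univ_quotient_of O A q.

Definition univ_embedding (C : category) (F : formData C) (O : orean F) (W Y : C)
  (m : hom W Y) : Prop := exists B : fib F Y, univ_embedding_of O B m.

Definition noetherian (C : category) (F : formData C) (O : orean F) : Prop :=
  [/\ forall X Y (f : hom X Y) (A : fib F X),
        inv O f (dir O f A) = join O A (Ker O f),
      forall X Y (f : hom X Y) (B : fib F Y),
        dir O f (inv O f B) = meet O B (Im O f),
      forall X Y (f : hom X Y), exists (Q : C) (q : hom X Q) (m : hom Q Y),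
        [/\ f = comp m q, univ_quotient_of O (Ker O f) q
          & univ_embedding_of O (Im O f) m],
      forall X (A B : fib F X), normal O A -> normal O B -> normal O (join O A B)
    & forall X (A B : fib F X),
        conormal O A -> conormal O B -> conormal O (meet O A B)].

Definition largest_below (C : category) (F : formData C) (X : C)
    (P : fib F X -> Prop) (A M : fib F X) : Prop :=
  [/\ P M, fle M A & forall N, P N -> fle N A -> fle N M].

Definition exact_join_decomposition (C : category) (F : formData C) (O : orean F) :
    Prop :=
  exists n c : forall X, fib F X -> fib F X,
    (forall X (A : fib F X), largest_below (@normal C F O X) A (n X A)) /\
    (forall X (A : fib F X), largest_below (@conormal C F O X) A (c X A)) /\
    (forall X (A : fib F X), A = join O (c X A) (n X A)) /\
    (forall X Y (f : hom X Y) (B : fib F Y), inv O f (n Y B) = n X (inv O f B)) /\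
    (forall X Y (f : hom X Y), dir O f (n X (top O X)) = n Y (Im O f)).

Definition markedPrunings (L : rankedSet) : formData (augCat L) :=
  FormData (@cluster_le L).

(* Main.v *)
Require Import Defs.
From mathcomp Require Import all_boot.
From mathcomp Require Import fingroup perm boolp.
Import Defs.

(* A morphism is determined by its positional function, and a cluster over X
   by two sets of positions of X: those whose image in X/K is an empty leaf, and
   those whose image in X/K is the marked empty leaf.  The pairs arising in this
   way are cut out by conditions ([marking]) that are stable under
   intersections and under preimages along positional functions; L <=_f N says
   that f maps both sets of L into those of N.  Hence fibres are complete
   lattices, f^* is preimage, and f_* exists since f^* preserves meets.
   A cluster is normal iff its mark is empty, and conormal iff each of its
   collapsed positions is an empty leaf or marked; this gives the closure
   conditions and the decomposition.  The identities for f^*f_* and f_*f^* use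
   only that the image of a positional function is closed under extension, and
   that it reflects the prefix order except at empty leaves, whose fibres are
   cones. *)

Set Implicit Arguments.
Unset Strict Implicit.
Unset Printing Implicit Defensive.

(** * Prefix order on positions *)

Section Trees.
Variable L : rankedSet.
Implicit Types X Y Z : tree L.

Lemma pcat_root X (a : Pos X) : pcat a (root _) = a.
Proof. by elim: a => //= l T r a ->. Qed.

Lemma sub_pcat X (a : Pos X) (b : Pos (sub a)) : sub (pcat a b) = sub b.
Proof. by elim: a b => //= l T p a IH b; exact: IH. Qed.

Lemma prefix_root X (a : Pos X) : prefix (root X) a.
Proof. by exists a. Qed.

Lemma prefix_child (l : L) (T : 'I_(ar l) -> tree L) p (a b : Pos (T p)) :
  prefix a b -> prefix (child p a) (child p b).
Proof. by case=> c ->; exists c. Qed.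

Lemma prefix_childE (l : L) (T : 'I_(ar l) -> tree L) p (a : Pos (T p))
    (b : Pos (node l T)) :
  prefix (child p a) b -> exists2 b', b = child p b' & prefix a b'.
Proof. by case=> /= c ->; exists (pcat a c) => //; exists c. Qed.

Lemma prefix_child_inv (l : L) (T : 'I_(ar l) -> tree L) p (a b : Pos (T p)) :
  prefix (child p a) (child p b) -> prefix a b.
Proof. by case/prefix_childE=> b' /child_inj2 ->. Qed.

Lemma prefix_root_inv X (a : Pos X) : prefix a (root X) -> a = root X.
Proof.
elim: a => // l T p a IH /prefix_childE [b' e]; by case: (root_child e).
Qed.

Lemma prefix_refl X (a : Pos X) : prefix a a.
Proof. by exists (root _); rewrite pcat_root. Qed.

Lemma prefix_trans X (a b c : Pos X) : prefix a b -> prefix b c -> prefix a c.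
Proof.
elim: a b c => [*|l T p a IH b c]; first exact: prefix_root.
case/prefix_childE=> b' -> ab /prefix_childE [c' -> bc].
by apply: prefix_child; apply: IH ab bc.
Qed.

Lemma prefix_leaf X (a b : Pos X) : prefix a b -> sub a = leaf -> b = a.
Proof.
case=> c -> e; rewrite -[RHS]pcat_root; congr pcat; exact: Pos_leaf2.
Qed.

(** Follow both words until they first differ. *)
Lemma longest_common_prefix X (a b : Pos X) :
  exists2 d, prefix d a /\ prefix d b &
    forall c, prefix c a -> prefix c b -> prefix c d.
Proof.
have rt Y (c : Pos Y) : exists2 d, prefix d (root Y) /\ prefix d c &
    forall e, prefix e (root Y) -> prefix e c -> prefix e d.
  by exists (root Y) => //; split; exact: prefix_root.
elim: a b => [Y b|l T p a IH]; first exact: rt.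
elim/node_case=> [|q b].
  by have [d [d1 d2] H] := rt _ (child p a); exists d => // e e1 e2; exact: H.
have [e|npq] := eqVneq p q; last first.
  exists (root _) => [|c]; first by split; exact: prefix_root.
  elim/node_case: c => [|r c]; first by move=> *; exact: prefix_root.
  move=> /prefix_childE [c1 e1 _] /prefix_childE [c2 e2 _].
  by case/eqP: npq; rewrite (child_inj1 e1) (child_inj1 e2).
subst q; have [d [d1 d2] H] := IH b.
exists (child p d) => [|c]; first by split; exact: prefix_child.
elim/node_case: c => [*|r c]; first exact: prefix_root.
move=> ca cb; have [a' e _] := prefix_childE ca.
move: (child_inj1 e) => ep; subst r.
by apply: prefix_child; apply: H; apply: prefix_child_inv.
Qed.

Lemma prefix_linear X (a b c : Pos X) :
  prefix a c -> prefix b c -> prefix a b \/ prefix b a.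
Proof.
elim: a b c => [Y b c _ _|l T p a IH b c]; first by left; exact: prefix_root.
case/prefix_childE=> c' -> ac; elim/node_case: b => [_|q b bc].
  by right; exact: prefix_root.
have [b' e _] := prefix_childE bc; move: (child_inj1 e) => eq; subst q.
have [H|H] := IH b c' ac (prefix_child_inv bc); [left|right]; exact: prefix_child.
Qed.

Fixpoint depth X (a : Pos X) : nat :=
  match a with root _ => 0 | child _ _ _ b => (depth b).+1 end.

Lemma prefix_depth X (a b : Pos X) : prefix a b -> depth b <= depth a -> a = b.
Proof.
elim: a b => [Y b _|l T p a IH b].
  by case: b.
by case/prefix_childE=> b' -> ab /=; rewrite ltnS => /(IH _ ab) ->.
Qed.

(** Well-foundedness in usable form: by [prefix_depth], an element of least depth has no proper
    prefix in [S]. *)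
Lemma shortest X (S : Pos X -> Prop) a : S a ->
  exists2 m, S m & forall b, S b -> depth m <= depth b.
Proof.
move=> Sa; pose D n := `[< exists2 b, S b & depth b = n >].
have exD : exists n, D n by exists (depth a); apply/asboolP; exists a.
case: (ex_minnP exD) => n /asboolP [m Sm <-] H; exists m => // b Sb.
by apply: H; apply/asboolP; exists b.
Qed.

(** * Collapse, tree isomorphisms and concatenation against the prefix order *)

Lemma collapse_mono X (K : Pos X -> bool) (a b : Pos X) :
  prefix a b -> prefix (collapse a K) (collapse b K).
Proof.
elim: a b K => [Y b K _|l T p a IH b K].
  suff -> : collapse (root Y) K = root _ by exact: prefix_root.
  by [].
case/prefix_childE=> b' -> ab /=; case: (K _) => /=; first exact: prefix_root.
by apply: prefix_child; apply: IH.
Qed.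

Lemma collapse_leaf X (K : Pos X -> bool) (a : Pos X) : eff K ->
  sub (collapse a K) = leaf <-> sub a = leaf \/ exists2 j, K j & prefix j a.
Proof.
elim: a K => [Y K HK|l T p a IH K].
  case: Y K HK => [|l T] K /= HK; first by split=> // _; left.
  case E: (K _); split=> //; first by move=> _; right; exists (root _); first exact: E;
    exact: prefix_root.
  by case=> // -[j Kj /prefix_root_inv e]; move: Kj; rewrite e E.
rewrite /=; case E: (K _) => HK.
  by split=> // _; right; exists (root _) => //; exact: prefix_root.
rewrite /= IH //; split=> -[H|[j Kj H]]; try by left.
  by right; exists (child p j) => //; exact: prefix_child.
move: Kj H; elim/node_case: j => [|q j]; first by rewrite E.
move=> Kj H; have [a' e _] := prefix_childE H.
move: (child_inj1 e) => eq; subst q; right; exists j => //.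
exact: prefix_child_inv H.
Qed.

(** Collapse changes no word outside the cones of the cut, so order can be created only where [a]
    lands on a leaf. *)
Lemma collapse_prefix X (K : Pos X -> bool) (a b : Pos X) :
  prefix (collapse a K) (collapse b K) ->
  prefix a b \/ sub (collapse a K) = leaf.
Proof.
elim: a b K => [Y b K _|l T p a IH b K]; first by left; exact: prefix_root.
rewrite /= (collapseE K b); case: (K _) => /=; first by right.
elim/node_case: b => /= [/prefix_root_inv e|q b].
  by have := root_child (esym e).
case/prefix_childE=> b' e H; move: (child_inj1 e) => eq; subst q.
move: H; rewrite -(child_inj2 e) => /IH [H|H]; last by right.
by left; apply: prefix_child.
Qed.

Lemma collapse_eq X (K : Pos X -> bool) (a b : Pos X) :
  collapse a K = collapse b K ->
  a = b \/ exists2 j, K j & prefix j a /\ prefix j b.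
Proof.
elim: a b K => [Y b K|l T p a IH b K].
  case: Y b K => [|l T] b K; first by left; rewrite (Pos_leaf b).
  rewrite (collapseE K b) /=; case E: (K _) => /=.
    by move=> _; right; exists (root _) => //; split; exact: prefix_root.
  by elim/node_case: b => [|p b] /=; [left | move/root_child].
rewrite /= (collapseE K b); case E: (K _) => /=.
  by move=> _; right; exists (root _) => //; split; exact: prefix_root.
elim/node_case: b => [e|q b e]; first by have := root_child (esym e).
move: (child_inj1 e) => eq; subst q.
have [->|[j Kj [j1 j2]]] := IH _ _ (child_inj2 e); first by left.
by right; exists (child p j) => //; split; exact: prefix_child.
Qed.

Lemma iso_pos_mono X Y (t : iso X Y) a b :
  prefix a b -> prefix (iso_pos t a) (iso_pos t b).
Proof.
elim: t a b => [//|l X' Y' s t IH] a b.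
elim/node_case: a => [_|p a] /=; first exact: prefix_root.
by case/prefix_childE=> b' -> ab /=; apply: prefix_child; apply: IH.
Qed.

Lemma iso_pos_prefix X Y (t : iso X Y) a b :
  prefix (iso_pos t a) (iso_pos t b) -> prefix a b.
Proof.
elim: t a b => [//|l X' Y' s t IH] a b.
elim/node_case: a => [_|p a] /=; first exact: prefix_root.
case/prefix_childE=> c; elim/node_case: b => [/root_child //|q b] /= e H.
move: (child_inj1 e) => /perm_inj eq; subst q.
by apply: prefix_child; apply: IH; rewrite (child_inj2 e).
Qed.

Lemma iso_pos_inj X Y (t : iso X Y) : injective (iso_pos t).
Proof.
elim: t => [//|l X' Y' s t IH] a b.
elim/node_case: a => [|p a]; elim/node_case: b => [|q b] //=.
move=> e; move: (child_inj1 e) => /perm_inj eq; subst q.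
by congr child; apply: IH; exact: child_inj2 e.
Qed.

Lemma iso_pos_surj X Y (t : iso X Y) b : exists a, iso_pos t a = b.
Proof.
elim: t b => [b|l X' Y' s t IH]; first by exists b.
elim/node_case=> [|q b]; first by exists (root _).
move: b; rewrite -(permKV s q) => b; have [a <-] := IH _ b.
by exists (child _ a).
Qed.

(** One cancellation suffices: injectivity of [iso_pos] yields the other. *)
Lemma iso_inv X Y (t : iso X Y) :
  exists t' : iso Y X, cancel (iso_pos t') (iso_pos t).
Proof.
elim: t => [|l X' Y' s t IH]; first by exists iso_leaf.
pose c q := cid (IH (s^-1 q)%g).
exists (iso_node s^-1%g (fun q =>
  eq_rect _ (fun r => iso (Y' r) (X' (s^-1 q)%g)) (projT1 (c q)) _ (permKV s q))).
elim/node_case=> [//|q b] /=.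
(* Replacing [permKV s q] by an arbitrary equation [e] with a free right-hand side lets the
   transport be destructed. *)
have cast q' (u : iso (Y' (s q')) (X' q')) r (e : s q' = r) (b' : Pos (Y' r)) :
    cancel (iso_pos u) (iso_pos (t q')) ->
    child (s q') (iso_pos (t q')
      (iso_pos (eq_rect _ (fun r => iso (Y' r) (X' q')) u _ e) b')) = child r b'.
  by move=> uK; case: _ / e b' => b' /=; rewrite uK.
exact: cast (projT2 (c q)).
Qed.

Lemma iso_pos_leaf X Y (t : iso X Y) a :
  sub (iso_pos t a) = leaf <-> sub a = leaf.
Proof.
elim: t a => [//|l X' Y' s t IH]; elim/node_case=> [|p a] //=; exact: IH.
Qed.

Lemma pcat_mono X (p : Pos X) a b : prefix a b -> prefix (pcat p a) (pcat p b).
Proof. by elim: p a b => //= l T q p IH a b ab; apply: prefix_child; apply: IH. Qed.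

Lemma pcat_prefix X (p : Pos X) a b : prefix (pcat p a) (pcat p b) -> prefix a b.
Proof. by elim: p a b => //= l T q p IH a b /prefix_child_inv; exact: IH. Qed.

(** The two subtrees are equal by [sub_pcat]; an isomorphism carries positions between them without
    casts. *)
Lemma sub_pcat_iso X (p : Pos X) (q : Pos (sub p)) :
  exists t : iso (sub (pcat p q)) (sub q),
    forall b, pcat p (pcat q (iso_pos t b)) = pcat (pcat p q) b.
Proof.
elim: p q => [Y q|l T r p IH q] /=.
  by exists (iso_id _) => b; rewrite iso_pos_id.
by have [t H] := IH q; exists t => b; rewrite H.
Qed.

(** Every position of [J] lies in a cone of [K], so pruning at [J] removes nothing that [K] keeps,
    and [K'] consists of the positions of [K] not yet cut by [J]. *)
Lemma prune_factor X (K J : Pos X -> bool) : eff K -> eff J ->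
  (forall j, J j -> sub (collapse j K) = leaf) ->
  exists (K' : Pos (prune J) -> bool) (u : iso (prune K') (prune K)),
    eff K' /\ forall a, iso_pos u (collapse (collapse a J) K') = collapse a K.
Proof.
elim: X K J => [|l T IH] K J HK HJ H.
  by exists (fun _ => false), iso_leaf; split=> // a; exact: Pos_leaf2.
(* [coll_node] takes the root values of [K] and [J] as separate arguments, so that a case analysis
   on them is well typed. *)
suff: exists (K' : Pos (prune J) -> bool) (u : iso (prune K') (prune K)),
    eff K' /\ forall a, iso_pos u (collapse (coll_node J (J (root _)) a) K')
                       = coll_node K (K (root _)) a.
  move=> [K' [u [HK' E]]]; exists K', u; split=> // a.
  by rewrite !(collapseE _ a) E.
have := H (root _); have {H} := fun p j => H (child p j); move: HK HJ => /=.
(* If [J] cuts the root, the hypothesis forces [K] to cut it too, and [K'] is empty. *)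
case: (J _) => [HK _ _|].
  case: (K _) HK => // HK H; last by have := H isT.
  by exists (fun _ => false), iso_leaf; split=> // a; exact: Pos_leaf2.
(* If [K] alone cuts the root, so does [K']; otherwise the cuts of the children are assembled. *)
case: (K _) => HK HJ H _.
  exists (fun a => node_case (P := fun _ => bool) true (fun _ _ => false) a), iso_leaf.
  by split=> [//|a]; exact: Pos_leaf2.
pose c p := cid (IH p _ _ (HK p) (HJ p) (H p)); pose d p := cid (projT2 (c p)).
have [u Hu] := iso_node1 (fun p => projT1 (d p)).
exists (fun a => node_case (P := fun _ => bool) false (fun p => projT1 (c p)) a), u.
split=> [p|a]; first exact: (proj1 (projT2 (d p))).
elim/node_case: a => [|p b]; first by rewrite iso_pos_root.
by rewrite /= Hu (proj2 (projT2 (d p))).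
Qed.

(** * Positional functions of tree morphisms, and factorizations through prunings and occurrences *)

Lemma posfun_mono X Y (f : mor X Y) a b :
  prefix a b -> prefix (posfun f a) (posfun f b).
Proof.
by move=> ab; apply: pcat_mono; apply: iso_pos_mono; apply: collapse_mono.
Qed.

Lemma sub_posfun X Y (f : mor X Y) a :
  sub (posfun f a) = leaf <-> sub (collapse a (mcut f)) = leaf.
Proof. by rewrite /posfun sub_pcat iso_pos_leaf. Qed.

Lemma posfun_leaf X Y (f : mor X Y) a : sub a = leaf -> sub (posfun f a) = leaf.
Proof.
by move=> H; apply/sub_posfun/collapse_leaf; [exact: ecut_eff | left].
Qed.

Lemma posfun_prefix X Y (f : mor X Y) a b :
  prefix (posfun f a) (posfun f b) -> prefix a b \/ sub (posfun f a) = leaf.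
Proof.
move=> /pcat_prefix /iso_pos_prefix /collapse_prefix [|H]; first by left.
by right; apply/sub_posfun.
Qed.

Lemma posfun_eq X Y (f : mor X Y) a b : posfun f a = posfun f b ->
  a = b \/ exists2 j, sub (posfun f j) = leaf & prefix j a /\ prefix j b.
Proof.
move=> /pcat_inj /iso_pos_inj /collapse_eq [|[j Kj H]]; first by left.
right; exists j => //; apply/sub_posfun/collapse_leaf; first exact: ecut_eff.
by right; exists j => //; exact: prefix_refl.
Qed.

(** The image is the whole cone over [mpos f], since collapse and tree isomorphisms are surjective
    on positions. *)
Lemma posfun_upclosed X Y (f : mor X Y) a y :
  prefix (posfun f a) y -> exists b, posfun f b = y.
Proof.
case=> c ->; rewrite /posfun.
have [d ->] : exists d, pcat (pcat (mpos f) (iso_pos (miso f) (collapse a (mcut f)))) c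
    = pcat (mpos f) d.
  have [t H] := occ_occ (iso_pos (miso f) (collapse a (mcut f))).
  have [e E] : exists e, iso_pos t e = c by exact: iso_pos_surj.
  by rewrite -E -H; eexists.
have [e <-] := iso_pos_surj (miso f) d; have [b <-] := collapse_surj e.
by exists b.
Qed.

Lemma mor_iso X Y (t : iso X Y) : exists f : mor X Y, posfun f =1 iso_pos t.
Proof.
have [u U] := iso_comp (iso_eq (prune0 X)) t.
by exists (@Mor L X Y (ecut0 X) (root Y) u) => a; rewrite [LHS]U prune0_collapse.
Qed.

(** The hypothesis says that the cut of [f] absorbs [J]; what is left of that cut is the cut of
    [h]. *)
Lemma mor_prune_factor X Y (J : ecut X) (f : mor X Y) :
  (forall j, J j -> sub (posfun f j) = leaf) ->
  exists h : mor (prune J) Y, forall a, posfun h (collapse a J) = posfun f a.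
Proof.
case: f => K p t H.
have [|K' [u [HK' E]]] := @prune_factor _ K J (ecut_eff K) (ecut_eff J).
  by move=> j /H /sub_posfun.
have [v V] := iso_comp u t; have [h Hh] := mor_of v HK'.
by exists h => a; rewrite Hh V E.
Qed.

(** The root goes to [mpos f], so [mpos f] is some [pcat p c]; the factor keeps the cut of [f] and
    has position [c]. *)
Lemma mor_sub_factor X Y (f : mor X Y) (p : Pos Y) : prefix p (posfun f (root X)) ->
  exists g : mor X (sub p), forall a, pcat p (posfun g a) = posfun f a.
Proof.
case: f => K q t; rewrite /posfun /= iso_pos_root pcat_root => -[c e]; subst q.
have [u U] := sub_pcat_iso c; have [v V] := iso_comp t u.
exists (Mor v) => a; by rewrite /posfun /= V U.
Qed.

End Trees.

(** * Positions and positional functions after adjoining 0 *)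

Section Augmented.
Variable L : rankedSet.
Implicit Types X Y Z : augCat L.

(* With no positions for 0, morphisms out of 0 are determined by [afun] as well. *)
Definition apos (X : augCat L) : Type :=
  match X with None => Empty_set | Some T => Pos T end.

Definition apre X : apos X -> apos X -> Prop :=
  match X as X0 return apos X0 -> apos X0 -> Prop with
  | None => fun _ _ => True
  | Some T => @prefix L T
  end.

Definition aleaf X : apos X -> Prop :=
  match X as X0 return apos X0 -> Prop with
  | None => fun _ => True
  | Some T => fun a => sub a = leaf
  end.

Definition afun X Y : hom X Y -> apos X -> apos Y :=
  match X as X0, Y as Y0 return @hom0 (treeCat L) X0 Y0 -> apos X0 -> apos Y0 with
  | None, _ => fun _ a => match a with end
  | Some _, None => fun f => match f with end
  | Some X, Some Y => @posfun L X Y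
  end.

Lemma afun_inj X Y (f g : hom X Y) : afun f =1 afun g -> f = g.
Proof.
case: X f g => [X|]; case: Y => [Y|] //= f g; first exact: posfun_inj.
all: by case: f; case: g.
Qed.

Lemma afun_id X : afun (idm X) =1 id.
Proof. by case: X => [X|[]] a; exact: posfun_id. Qed.

Lemma afun_comp X Y Z (g : hom Y Z) (f : hom X Y) :
  afun (comp g f) =1 afun g \o afun f.
Proof.
case: X f => [X|]; case: Y g => [Y|]; case: Z => [Z|] //= g f; try by case: f.
by move=> a; exact: posfun_comp.
Qed.

Lemma apre_refl X (a : apos X) : apre a a.
Proof. by case: X a => [X|] a //; exact: prefix_refl. Qed.

Lemma apre_trans X (a b c : apos X) : apre a b -> apre b c -> apre a c.
Proof. by case: X a b c => [X|] a b c //; exact: prefix_trans. Qed.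

Lemma apre_leaf X (a b : apos X) : apre a b -> aleaf a -> b = a.
Proof. by case: X a b => [X|[]] a b; exact: prefix_leaf. Qed.

Lemma apre_lcp X (a b : apos X) : exists2 d, apre d a /\ apre d b &
  forall c, apre c a -> apre c b -> apre c d.
Proof. by case: X a b => [X|[]] a b; exact: longest_common_prefix. Qed.

Lemma apre_linear X (a b c : apos X) : apre a c -> apre b c -> apre a b \/ apre b a.
Proof. by case: X a b c => [X|[]] a b c; exact: prefix_linear. Qed.

Lemma apos_root X (a : apos X) : exists r : apos X, forall b, apre r b.
Proof.
by case: X a => [X|[]] a; exists (root X) => b; exact: prefix_root.
Qed.

Lemma minimal_in X (S : apos X -> Prop) a : S a ->
  exists2 m, S m & forall b, S b -> apre b m -> b = m.
Proof.
case: X S a => [X|] S a; last by case: a.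
move=> /= /shortest [m Sm H].
by exists m => // b Sb bm; apply: prefix_depth bm _; exact: H.
Qed.

Lemma afun_mono X Y (f : hom X Y) a b : apre a b -> apre (afun f a) (afun f b).
Proof.
case: X f a b => [X|] f a b; last by case: a.
by case: Y f => [Y|] f; [exact: posfun_mono|case: f].
Qed.

Lemma afun_leaf X Y (f : hom X Y) a : aleaf a -> aleaf (afun f a).
Proof.
case: X f a => [X|] f a; last by case: a.
by case: Y f => [Y|] f; [exact: posfun_leaf|case: f].
Qed.

Lemma afun_pre X Y (f : hom X Y) a b :
  apre (afun f a) (afun f b) -> apre a b \/ aleaf (afun f a).
Proof.
case: X f a b => [X|] f a b; last by case: a.
by case: Y f => [Y|] f; [exact: posfun_prefix|case: f].
Qed.

Lemma afun_eq X Y (f : hom X Y) a b : afun f a = afun f b ->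
  a = b \/ exists2 j, aleaf (afun f j) & apre j a /\ apre j b.
Proof.
case: X f a b => [X|] f a b; last by case: a.
by case: Y f => [Y|] f; [exact: posfun_eq|case: f].
Qed.

Lemma afun_up X Y (f : hom X Y) a y : apre (afun f a) y -> exists b, afun f b = y.
Proof.
case: X f a => [X|] f a; last by case: a.
by case: Y f y => [Y|] f y; [exact: posfun_upclosed|case: f].
Qed.

Lemma iso_afun X Y (i : hom X Y) : is_iso i -> exists g : hom Y X,
  cancel (afun i) (afun g) /\ cancel (afun g) (afun i).
Proof.
case=> g [gi ig]; exists g; split=> a.
  by have := afun_comp g i a; rewrite gi afun_id.
by have := afun_comp i g a; rewrite ig afun_id.
Qed.

Lemma aleaf_iso X Y (i : hom X Y) a : is_iso i -> aleaf (afun i a) <-> aleaf a.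
Proof.
case/iso_afun=> g [gi _]; split; last exact: afun_leaf.
by move/(afun_leaf g); rewrite gi.
Qed.

Lemma afun_pruning (X : tree L) (K : ecut X) a :
  afun (augPruning K) a = collapse a K.
Proof. exact: posfun_pruning. Qed.

Lemma afun_occurrence (Y : tree L) (p : Pos Y) b :
  afun (augOccurrence p) b = pcat p b.
Proof. exact: posfun_occurrence. Qed.

(** * The classes E and M: cancellation, factorization, closure under isomorphisms *)

Lemma classE_surj X Y (q : hom X Y) : classE q -> forall y, exists a, afun q a = y.
Proof.
case=> {X Y q} [X Y K i /iso_afun [g [_ ig]] y|[]].
have [a Ha] := collapse_surj (afun g y); exists a.
by rewrite afun_comp /= posfun_pruning Ha; exact: ig.
Qed.

Lemma classE_epi X Y Z (q : hom X Y) (g h : hom Y Z) :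
  classE q -> comp g q = comp h q -> g = h.
Proof.
move=> /classE_surj qs e; apply: afun_inj => y; have [a <-] := qs y.
by have := congr1 (fun f => afun f a) e; rewrite !afun_comp.
Qed.

(** Cut positions become leaves under [q], hence under [f], so [f] factors through the pruning; the
    isomorphism after the pruning is then undone. *)
Lemma classE_factor X Q Y (q : hom X Q) (f : hom X Y) : classE q ->
  (forall a, aleaf (afun q a) -> aleaf (afun f a)) -> exists h, comp h q = f.
Proof.
move=> qE; case: qE Y f => {X Q q} [X Q K i iI Y|Y f _]; last first.
  by exists f; exact: comp_idr.
case: Y => [Y|] f H; last by case: f.
have [|h Hh] := @mor_prune_factor L X Y K f.
  move=> j Kj; apply: H; rewrite afun_comp; apply/(aleaf_iso _ iI).
  rewrite afun_pruning; apply/collapse_leaf; first exact: ecut_eff.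
  by right; exists j => //; exact: prefix_refl.
have {H} [g [gi ig]] := iI.
exists (comp (h : hom (Some (prune K) : augCat L) (Some Y : augCat L)) g).
rewrite -comp_assoc (comp_assoc g) gi comp_idl.
apply: afun_inj => a; rewrite afun_comp /= posfun_pruning; exact: Hh.
Qed.

Lemma classM_inj X Y (m : hom X Y) : classM m -> injective (afun m).
Proof.
case=> {X Y m} [X Y p i /iso_afun [g [gi _]] a b|X []].
by rewrite !afun_comp /= !posfun_occurrence => /pcat_inj /(can_inj gi).
Qed.

Lemma classM_mono X Y Z (m : hom Y Z) (g h : hom X Y) :
  classM m -> comp m g = comp m h -> g = h.
Proof.
move=> /classM_inj mi e; apply: afun_inj => a; apply: mi.
by have := congr1 (fun f => afun f a) e; rewrite !afun_comp.
Qed.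

(** At the root of [X] the hypothesis puts the image of [f] inside the cone of the occurrence. If
    [W] is 0, it prevents [X] from having a root, so [X] is 0. *)
Lemma classM_factor X W Y (m : hom W Y) (f : hom X Y) : classM m ->
  (forall a, exists w, apre (afun m w) (afun f a)) -> exists g, comp m g = f.
Proof.
move=> mM; case: mM X f => {W Y m} [W Y p i iI X|Y X]; last first.
  case: X => [X|] f H; first by have [[]] := H (root X).
  by exists (tt : hom zero zero); apply: afun_inj; case.
case: X => [X|] f H; last by exists (from0 _); apply: afun_inj; case.
have [w Hw] := H (root X).
have [|g Hg] := @mor_sub_factor L X Y f p.
  apply: prefix_trans Hw; rewrite afun_comp /= posfun_occurrence.
  by exists (afun i w).
have {H} [j [ji ij]] := iI.
exists (comp j (g : hom (Some X : augCat L) (Some (sub p) : augCat L))).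
rewrite -comp_assoc (comp_assoc i) ij comp_idl.
apply: afun_inj => a; rewrite afun_comp /= posfun_occurrence; exact: Hg.
Qed.

Lemma classM_leaf X Y (m : hom X Y) a : classM m -> aleaf (afun m a) -> aleaf a.
Proof.
move=> mM; case: mM a => {X Y m} [X Y p i iI a|X []].
by rewrite afun_comp /= posfun_occurrence sub_pcat => /(aleaf_iso _ iI).
Qed.

Lemma classE_isol X Y Z (q : hom X Y) (i : hom Y Z) :
  classE q -> is_iso i -> classE (comp i q).
Proof.
move=> qE; case: qE Z i => {X Y q} [X Y K j jI|] [Z|] i iI; try by case: i iI.
  rewrite comp_assoc; apply: classE_pruning.
  have [i' [i1 i2]] := iI; have [j' [j1 j2]] := jI; exists (comp j' i'); split.
    by rewrite -comp_assoc (comp_assoc i') i1 comp_idl j1.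
  by rewrite -comp_assoc (comp_assoc j) j2 comp_idl i2.
  (* The inverse would be a map from a tree to 0. *)
  by have [[]] := iI.
by rewrite comp_idr; case: (i); exact: classE_id0.
Qed.

Lemma classM_isor W X Y (m : hom X Y) (i : hom W X) :
  classM m -> is_iso i -> classM (comp m i).
Proof.
move=> mM; case: mM W i => {X Y m} [X Y p j jI|X] [W|] i iI.
- rewrite -comp_assoc; apply: classM_occurrence.
  have [i' [i1 i2]] := iI; have [j' [j1 j2]] := jI; exists (comp i' j'); split.
    by rewrite -comp_assoc (comp_assoc j') j1 comp_idl i1.
  by rewrite -comp_assoc (comp_assoc i) i2 comp_idl j2.
- exact: classM_from0.
- by case: i iI.
- exact: classM_from0.
Qed.

(** A triple [(K, p, t)] is the pruning at [K], then [t], then the occurrence at [p]; maps out of 0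
    factor through 0. *)
Lemma image_factorization X Y (f : hom X Y) :
  exists Q (q : hom X Q) (m : hom Q Y), [/\ f = comp m q, classE q & classM m].
Proof.
case: X f => [X|] f; last first.
  exists zero, (idm zero), (from0 Y); split; [by apply: afun_inj; case|exact: classE_id0|].
  exact: classM_from0.
case: Y f => [Y|] f; last by case: f.
case: f => K p t; have [t' tK] := iso_inv t.
have [i Hi] := mor_iso t; have [j Hj] := mor_iso t'.
pose i' : hom (Some (prune K) : augCat L) (Some (sub p) : augCat L) := i.
have iI : is_iso i'.
  exists (j : hom (Some (sub p) : augCat L) (Some (prune K) : augCat L)).
  split; apply: afun_inj => a; rewrite afun_comp afun_id /= Hi Hj; last exact: tK.
  by apply: (@iso_pos_inj _ _ _ t); rewrite tK.
exists (Some (sub p)), (comp i' (augPruning K)), (augOccurrence p); split.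
- apply: afun_inj => a; rewrite [RHS]afun_comp [RHS]afun_occurrence [in RHS]afun_comp.
  by rewrite [RHS](congr1 (pcat p) (Hi _)) afun_pruning.
- exact: classE_pruning.
- rewrite -[augOccurrence p]comp_idr; apply: classM_occurrence; exact: is_iso_id.
Qed.

End Augmented.

(** * Clusters as pairs of sets of positions *)

Section Clusters.
Variable L : rankedSet.
Implicit Types X Y Z : augCat L.

(* E is the preimage of the empty leaves of X/K and M that of the marked leaf. *)
Record marking X (E M : apos X -> Prop) : Prop := Marking {
  marking_leaf : forall a, aleaf a -> E a;
  marking_up : forall a b, apre a b -> E a -> E b;
  marking_sub : forall a, M a -> E a;
  marking_mark_up : forall a b, apre a b -> M a -> M b;
  marking_mark_down : forall a b, apre a b -> E a -> M b -> M a;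
  marking_common_prefix : forall a b, M a -> M b -> exists2 d, M d & apre d a /\ apre d b
}.

Lemma marking_min X (E M : apos X -> Prop) a : marking E M -> M a ->
  exists2 m, M m & forall b, M b -> apre m b.
Proof.
move=> v /minimal_in [m Mm H]; exists m => // b Mb.
have [d Md [dm db]] := marking_common_prefix v Mm Mb.
by rewrite -(H _ Md dm).
Qed.

Definition collapsed X (c : cospan X) (a : apos X) : Prop := aleaf (afun (cquo c) a).

(** Quantifying over positions of the marking object treats both cases at once: 0 has none, and the
    set is then empty. *)
Definition marked X (c : cospan X) (a : apos X) : Prop :=
  exists w, afun (cquo c) a = afun (cmark c) w.

Lemma apos01 X (x y : apos X) : X = zero \/ X = one -> x = y /\ aleaf x.
Proof.
by case=> e; subst X; move: x y => // x y; rewrite (Pos_leaf x) (Pos_leaf y).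
Qed.

(** All extensions of a collapsed position share its image. Marked positions have one common image,
    so two of them coincide or extend a common collapsed position, which is then marked. *)
Lemma marking_cospan X (c : cospan X) : marking (collapsed c) (marked c).
Proof.
have lf a : marked c a -> collapsed c a.
  by case=> w e; rewrite /collapsed e; apply: afun_leaf; case: (apos01 w w (mobj01 c)).
have up a b : apre a b -> collapsed c a -> afun (cquo c) b = afun (cquo c) a.
  by move=> ab Ea; apply: apre_leaf Ea; exact: afun_mono.
split=> // [a|a b ab Ea|a b ab Ma|a b ab Ea [w Mb]|a b Ma Mb].
- exact: afun_leaf.
- by rewrite /collapsed (up _ _ ab Ea).
- by case: (Ma) => w e; exists w; rewrite (up _ _ ab) //; exact: lf.
- by exists w; rewrite -(up _ _ ab).
- case: (Ma) (Mb) => [w ew] [w' ew'].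
  have [|e|[j lj [ja jb]]] := @afun_eq _ _ _ (cquo c) a b.
  + by rewrite ew ew'; case: (apos01 w w' (mobj01 c)) => ->.
  + by exists a => //; split; [|rewrite -e]; exact: apre_refl.
  + by exists j => //; exists w; rewrite -(up _ _ ja).
Qed.

(** Conversely, the condition on collapsed positions yields [h] by [classE_factor], and the
    condition on marked ones yields [k]. *)
Lemma cospan_leP X Y (f : hom X Y) (c : cospan X) (d : cospan Y) :
  cospan_le f c d <->
  (forall a, collapsed c a -> collapsed d (afun f a)) /\
  (forall a, marked c a -> marked d (afun f a)).
Proof.
have ev W Z (g g' : hom W Z) : g = g' -> forall a, afun g a = afun g' a by move=> ->.
split=> [[h [k [e1 e2]]]|[HE HM]].
  have {}e1 a : afun h (afun (cquo c) a) = afun (cquo d) (afun f a).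
    by have := ev _ _ _ _ e1 a; rewrite !afun_comp.
  split=> [a Ea|a [w ew]]; first by rewrite /collapsed -e1; exact: afun_leaf.
  exists (afun k w); rewrite -e1 ew.
  by have := ev _ _ _ _ e2 w; rewrite !afun_comp.
have [|h Hh] := @classE_factor L _ _ _ _ (comp (cquo d) f) (cquoE c).
  by move=> a /HE; rewrite afun_comp.
suff [k Hk] : exists k, comp h (cmark c) = comp (cmark d) k by exists h, k.
have {HE} hq a : afun h (afun (cquo c) a) = afun (cquo d) (afun f a).
  by rewrite -[RHS]afun_comp -Hh afun_comp.
case: c h HM hq {Hh} => Q q U u qE uM [?|?] h HM hq; subst U.
  by exists (from0 (mobj d)); apply: afun_inj; case.
(* A position over the marked leaf of [c] has a marked image in [d], which rules out the empty
   marking there. *)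
have [a qa] := classE_surj qE (afun u (root leaf)).
have [|w Hw] := HM a; first by exists (root leaf).
case: d {HM} h hq w Hw => R r V v rE vM [?|?] h hq w Hw; subst V => //.
exists (idm one); apply: afun_inj => x; rewrite afun_comp comp_idr.
have -> : x = root leaf by exact: Pos_leaf.
transitivity (afun h (afun u (root leaf))) => //.
by rewrite -qa hq Hw; congr (afun v); exact: Pos_leaf.
Qed.

(** Comparisons in both directions are mutually inverse: on quotients because maps in E are epic, on
    marks because 0 and 1 have at most one position. *)
Lemma cospan_isoP X (c d : cospan X) : cospan_iso c d <->
  (forall a, collapsed c a <-> collapsed d a) /\
  (forall a, marked c a <-> marked d a).
Proof.
have le_iso (c' d' : cospan X) : cospan_iso c' d' -> cospan_le (idm X) c' d'.
  by case=> h [k [_ _ e1 e2]]; exists h, k; rewrite comp_idr.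
have le_sym (c' d' : cospan X) : cospan_iso c' d' -> cospan_le (idm X) d' c'.
  case=> h [k [[h' [h1 h2]] [k' [k1 k2]] e1 e2]]; exists h', k'.
  rewrite comp_idr -e1 comp_assoc h1 comp_idl; split=> //.
  rewrite -[LHS]comp_idr -k2 -comp_assoc (comp_assoc (cmark d')) -e2.
  by rewrite -comp_assoc (comp_assoc h') h1 comp_idl.
split=> [H|[HE HM]].
  have /cospan_leP [E1 M1] := le_iso _ _ H; have /cospan_leP [E2 M2] := le_sym _ _ H.
  split=> a; split; [move/E1|move/E2|move/M1|move/M2]; by rewrite afun_id.
have [h [k [e1 e2]]] : cospan_le (idm X) c d.
  by apply/cospan_leP; split=> a; rewrite afun_id; [move/HE|move/HM].
have [h' [k' [e1' e2']]] : cospan_le (idm X) d c.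
  by apply/cospan_leP; split=> a; rewrite afun_id; [move/HE|move/HM].
rewrite !comp_idr in e1 e1'.
exists h, k; split=> //.
- exists h'; split; [apply: classE_epi (cquoE c) _|apply: classE_epi (cquoE d) _].
    by rewrite -comp_assoc e1 comp_idl.
  by rewrite -comp_assoc e1' comp_idl.
- by exists k'; split; apply: afun_inj => x;
    [case: (apos01 (afun (comp k' k) x) (afun (idm _) x) (mobj01 c))
    |case: (apos01 (afun (comp k k') x) (afun (idm _) x) (mobj01 d))].
Qed.

Definition rep X (A : cluster X) : cospan X := projT1 (cid (svalP A)).

Lemma repE X (A : cluster X) : cluster_of (rep A) = A.
Proof.
rewrite /rep; case: (cid (svalP A)) => c /=; case: A => A pA /= e.
subst A; congr exist; exact: Prop_irrelevance.
Qed.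

Definition colset X (A : cluster X) := collapsed (rep A).
Definition markset X (A : cluster X) := marked (rep A).

Lemma marking_cluster X (A : cluster X) : marking (colset A) (markset A).
Proof. exact: marking_cospan. Qed.

Lemma cluster_leP X Y (f : hom X Y) (A : cluster X) (B : cluster Y) :
  cluster_le f A B <->
  (forall a, colset A a -> colset B (afun f a)) /\ (forall a, markset A a -> markset B (afun f a)).
Proof.
by rewrite -[A in cluster_le _ A]repE -[B in cluster_le _ _ B]repE cluster_leE cospan_leP.
Qed.

Lemma cluster_eqP X (A B : cluster X) :
  (forall a, colset A a <-> colset B a) -> (forall a, markset A a <-> markset B a) -> A = B.
Proof.
move=> HE HM; rewrite -[A]repE -[B]repE /cluster_of.
suff e : cospan_iso (rep A) = cospan_iso (rep B) :> (cospan X -> Prop).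
  move: (ex_intro _ _ _) (ex_intro _ _ _); rewrite e => p q.
  by congr exist; exact: Prop_irrelevance.
apply: funext => c; apply: propext; split=> /cospan_isoP [H1 H2].
  by apply/cospan_isoP; split=> a; [rewrite -H1|rewrite -H2];
    apply: iff_sym; [exact: HE|exact: HM].
by apply/cospan_isoP; split=> a; [rewrite -H1|rewrite -H2]; [exact: HE|exact: HM].
Qed.

(** Converse of [marking_cospan]: cut at the prefix-minimal nonleaf positions of [E], and mark the
    leaf to which all of [M] collapses. *)
Lemma cospan_of_marking X (E M : apos X -> Prop) : marking E M ->
  exists c : cospan X, (forall a, collapsed c a <-> E a) /\ (forall a, marked c a <-> M a).
Proof.
case: X E M => [X|] E M v; last first.
  have c : cospan (None : augCat L).
    exact: (@Cospan L zero zero (idm zero) zero (idm zero) (classE_id0 L)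
      (classM_from0 zero) (or_introl erefl)).
  by exists c; split; case.
pose K (a : Pos X) := `[< [/\ E a, sub a <> leaf & forall b, E b -> prefix b a -> b = a] >].
have [K1 K2] : (forall a, K a -> sub a <> leaf) /\
    (forall a b, K a -> K b -> prefix a b -> a = b).
  split=> [a /asboolP [] //|a b /asboolP [Ea _ _] /asboolP [_ _ H] ab]; exact: H.
pose J := ECut K1 K2; pose q := augPruning J.
have qE : classE q.
  rewrite -[q]comp_idl; apply: classE_pruning; exact: is_iso_id.
have colE a : aleaf (afun q a) <-> E a.
  rewrite afun_pruning; apply: (iff_trans (collapse_leaf _ (ecut_eff J))); split.
    case=> [|[j /asboolP [Ej _ _] ja]]; first exact: (marking_leaf v).
    exact: (marking_up v) ja Ej.
  move=> Ea; have [|anl] := pselect (sub a = leaf); [by left|right].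
  (* The minimal prefix of [a] in [E] is the cut position collapsing [a]; it is no leaf, because a
     leaf has no proper extension and [a] is no leaf. *)
  have [|j [Ej ja] H] := @minimal_in L (Some X) (fun b => E b /\ prefix b a) a.
    by split=> //; exact: prefix_refl.
  exists j => //; apply/asboolP; split=> [//|jl|b Eb bj].
    by have := prefix_leaf ja jl; congruence.
  by apply: (H b _ bj); split=> //; apply: prefix_trans bj ja.
have [[m Mm]|nM] := pselect (exists m, M m); last first.
  exists (@Cospan L (Some X) _ q zero (from0 _) qE (classM_from0 _) (or_introl erefl)).
  split=> [a|a]; first exact: colE.
  by split=> [[[]]|Ma]; case: nM; exists a.
have ml : sub (posfun (q : mor X _) m) = leaf by apply/colE; exact: (marking_sub v).
have [u uM Hu] : exists2 u : hom (one : augCat L) (Some (prune J)), classM u &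
    forall w, afun u w = afun q m.
  (* For a general position, the domain of the occurrence can be rewritten to the empty leaf. *)
  have W (Y : tree L) (p : Pos Y) : sub p = leaf ->
      exists2 u : hom (one : augCat L) (Some Y : augCat L), classM u & forall w, afun u w = p.
    move=> pl.
    have : exists2 u : hom (Some (sub p) : augCat L) (Some Y : augCat L), classM u &
        forall w, afun u w = p.
      exists (augOccurrence p) => [|w].
        rewrite -[augOccurrence p]comp_idr; apply: classM_occurrence; exact: is_iso_id.
      rewrite afun_occurrence -[RHS]pcat_root; congr pcat; exact: Pos_leaf2.
    by rewrite pl.
  exact: W.
exists (@Cospan L (Some X) _ q one u qE uM (or_intror erefl)).
split=> [a|a]; first exact: colE.
split=> [[w]|Ma].
  (* The mark passes from [m] down to the shared collapsed prefix [j] and up to [a]. *)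
  rewrite [afun _ w]Hu => e; have [<-//|[j lj [jm ja]]] := afun_eq (esym e).
  apply: (marking_mark_up v) ja _; apply: (marking_mark_down v) jm _ Mm; exact/colE.
exists (root leaf); rewrite [RHS]Hu.
have [d Md [da dm]] := marking_common_prefix v Ma Mm.
have ld : aleaf (afun q d) by apply/colE; exact: (marking_sub v).
by rewrite (apre_leaf (afun_mono q da) ld) (apre_leaf (afun_mono q dm) ld).
Qed.

(** Equalities of predicates, not equivalences, so that [colsetE] and [marksetE] serve as rewriting
    rules. *)
Lemma cluster_of_marking X (E M : apos X -> Prop) : marking E M ->
  exists A : cluster X, colset A = E /\ markset A = M.
Proof.
case/cospan_of_marking=> c [HE HM]; exists (cluster_of c).
have /cospan_isoP [H1 H2] : cospan_iso (rep (cluster_of c)) c.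
  have e : cospan_iso (rep (cluster_of c)) = cospan_iso c.
    exact: (congr1 (fun B : cluster X => sval B) (repE (cluster_of c))).
  rewrite e; exact: cospan_iso_refl.
split; apply: funext => a; apply: propext.
  by rewrite -HE; exact: H1.
by rewrite -HM; exact: H2.
Qed.

Definition cluster_with X (E M : apos X -> Prop) (v : marking E M) : cluster X :=
  projT1 (cid (cluster_of_marking v)).

Lemma colsetE X (E M : apos X -> Prop) (v : marking E M) : colset (cluster_with v) = E.
Proof. exact: (proj1 (projT2 (cid (cluster_of_marking v)))). Qed.

Lemma marksetE X (E M : apos X -> Prop) (v : marking E M) : markset (cluster_with v) = M.
Proof. exact: (proj2 (projT2 (cid (cluster_of_marking v)))). Qed.

End Clusters.

(** * The orean form of marked prunings *)

Section Form.
Variable L : rankedSet.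
Implicit Types X Y Z : augCat L.
Local Notation F := (markedPrunings L).

Lemma cmpP X Y (f : hom X Y) (A : fib F X) (B : fib F Y) :
  cmp f A B <->
  (forall a, colset A a -> colset B (afun f a)) /\ (forall a, markset A a -> markset B (afun f a)).
Proof. exact: cluster_leP. Qed.

Lemma fleP X (A B : fib F X) : fle A B <->
  (forall a, colset A a -> colset B a) /\ (forall a, markset A a -> markset B a).
Proof.
rewrite /fle cmpP; split=> -[H1 H2]; split=> a; [move/H1|move/H2|move/H1|move/H2];
  by rewrite afun_id.
Qed.

Lemma fle_refl X (A : fib F X) : fle A A.
Proof. by apply/fleP. Qed.

Lemma fle_trans X (A B C : fib F X) : fle A B -> fle B C -> fle A C.
Proof.
by move=> /fleP [E1 M1] /fleP [E2 M2]; apply/fleP; split=> a; [move/E1/E2|move/M1/M2].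
Qed.

Lemma fle_anti X (A B : fib F X) : fle A B -> fle B A -> A = B.
Proof.
move=> /fleP [E1 M1] /fleP [E2 M2]; apply: cluster_eqP => a; split; auto.
Qed.

Lemma markedPrunings_form : is_form F.
Proof.
split=> [X A|X Y Z f g A B C|X A B]; [exact: fle_refl| |exact: fle_anti].
move=> /cmpP [E1 M1] /cmpP [E2 M2]; apply/cmpP.
by split=> a; rewrite afun_comp; [move/E1/E2|move/M1/M2].
Qed.

(** The longest common prefix extends the common prefix marked in each [A], so it is marked in all
    of them. *)
Lemma marking_inf X (S : cluster X -> Prop) :
  marking (fun a => forall A, S A -> colset A a) (fun a => forall A, S A -> markset A a).
Proof.
split=> [a la A SA|a b ab Ea A SA|a Ma A SA|a b ab Ma A SA|a b ab Ea Mb A SA|a b Ma Mb].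
- exact: (marking_leaf (marking_cluster A)).
- exact: (marking_up (marking_cluster A)) ab (Ea A SA).
- exact: (marking_sub (marking_cluster A)) (Ma A SA).
- exact: (marking_mark_up (marking_cluster A)) ab (Ma A SA).
- exact: (marking_mark_down (marking_cluster A)) ab (Ea A SA) (Mb A SA).
have [d [da db] H] := apre_lcp a b; exists d => // A SA.
have [e Me [ea eb]] := marking_common_prefix (marking_cluster A) (Ma A SA) (Mb A SA).
exact: (marking_mark_up (marking_cluster A)) (H e ea eb) Me.
Qed.

Definition cinf X (S : cluster X -> Prop) : fib F X := cluster_with (marking_inf S).

Lemma cinfP X (S : cluster X -> Prop) (D : fib F X) :
  fle D (cinf S) <-> forall A : fib F X, S A -> fle D A.
Proof.
rewrite fleP colsetE marksetE; split=> [[H1 H2] A SA|H].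
  by apply/fleP; split=> a; [move/H1|move/H2]; apply.
by split=> a Da A /H /fleP [H1 H2]; [exact: H1|exact: H2].
Qed.

Lemma marking_bot X : marking (@aleaf L X) (fun=> False).
Proof. by split=> // a b ab la; rewrite (apre_leaf ab la). Qed.

(** Most conditions follow from monotonicity; the work is to lift a marked common prefix [e] of the
    two images to [X]. *)
Lemma marking_preim X Y (f : hom X Y) (B : cluster Y) :
  marking (fun a => colset B (afun f a)) (fun a => markset B (afun f a)).
Proof.
have v := marking_cluster B.
split=> [a la|a b ab|a|a b ab|a b ab|a b Ma Mb].
- by apply: (marking_leaf v); exact: afun_leaf.
- exact: (marking_up v) (afun_mono f ab).
- exact: (marking_sub v).
- exact: (marking_mark_up v) (afun_mono f ab).
- exact: (marking_mark_down v) (afun_mono f ab).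
have [e Me [ea eb]] := marking_common_prefix v Ma Mb.
have [r rr] := apos_root a.
(* If [e] is a prefix of the image of the root, the root is the prefix sought; otherwise [e] is
   itself the image of some [c]. *)
have [re|er] := apre_linear (afun_mono f (rr a)) ea; last first.
  by exists r => //; apply: (marking_mark_up v) er Me.
have [c ec] := afun_up re; subst e.
(* If [c] goes to a nonleaf, it is a prefix of [a] and [b]. If it goes to a leaf, [a] and [b] have
   the same image and [afun_eq] gives the prefix. *)
have [lc|nlc] := pselect (aleaf (afun f c)); last first.
  exists c => //; have [//|] := afun_pre ea; have [//|] := afun_pre eb; by [].
have [|e|[j lj [ja jb]]] := @afun_eq _ _ _ f a b.
- by rewrite (apre_leaf ea lc) (apre_leaf eb lc).
- by exists a => //; split; [|rewrite -e]; exact: apre_refl.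
- by exists j => //; rewrite -(apre_leaf (afun_mono f ja) lj).
Qed.

(** The empty intersection: every position is collapsed and marked. *)
Definition ctop X : fib F X := cinf (fun=> False).
Definition cbot X : fib F X := cluster_with (marking_bot X).
Definition cmeet X (A B : fib F X) : fib F X := cinf (fun D => D = A \/ D = B).
Definition cjoin X (A B : fib F X) : fib F X := cinf (fun D => fle A D /\ fle B D).
Definition cinv X Y (f : hom X Y) (B : fib F Y) : fib F X := cluster_with (marking_preim f B).
Definition cdir X Y (f : hom X Y) (A : fib F X) : fib F Y := cinf (fun B => cmp f A B).

Lemma cinvP X Y (f : hom X Y) (A : fib F X) (B : fib F Y) :
  cmp f A B <-> fle A (cinv f B).
Proof. by rewrite cmpP fleP colsetE marksetE. Qed.

Lemma cdirP X Y (f : hom X Y) (A : fib F X) (B : fib F Y) :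
  fle (cdir f A) B <-> cmp f A B.
Proof.
split=> [H|H]; last by have /cinfP := fle_refl (cdir f A); apply.
suff /cmpP [E1 M1] : cmp f A (cdir f A).
  by move/fleP: H => [E2 M2]; apply/cmpP; split=> a; [move/E1/E2|move/M1/M2].
apply/cmpP; rewrite colsetE marksetE.
by split=> a Aa D /cmpP [E M]; [exact: E|exact: M].
Qed.

Lemma cmeetP X (A B D : fib F X) : fle D (cmeet A B) <-> fle D A /\ fle D B.
Proof.
rewrite cinfP; split=> [H|[H1 H2] _ [->|->]] //.
by split; apply: H; [left|right].
Qed.

Lemma cjoinP X (A B D : fib F X) : fle (cjoin A B) D <-> fle A D /\ fle B D.
Proof.
split=> [H|H]; last by have /cinfP := fle_refl (cjoin A B); apply.
by split; apply: fle_trans H; apply/cinfP => C [].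
Qed.

Lemma fle_yoneda X (A B : fib F X) : (forall D, fle A D <-> fle B D) -> A = B.
Proof. by move=> H; apply: fle_anti; apply/H; exact: fle_refl. Qed.

Lemma cinv_comp X Y Z (g : hom Y Z) (f : hom X Y) A :
  cinv (comp g f) A = cinv f (cinv g A).
Proof. by apply: cluster_eqP => a; rewrite !(colsetE, marksetE) afun_comp. Qed.

Lemma cinv_id X A : cinv (idm X) A = A.
Proof. by apply: cluster_eqP => a; rewrite !(colsetE, marksetE) afun_id. Qed.

Definition clusters_orean : orean F.
Proof.
refine (@Orean _ F cbot ctop cjoin cmeet cdir cinv _ _ cjoinP cmeetP cdirP cinvP
  _ _ cinv_id cinv_comp).
- move=> X A; apply/fleP; rewrite colsetE marksetE; split=> // a.
  exact: (marking_leaf (marking_cluster A)).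
- by move=> X A; apply/cinfP.
(* Functoriality of direct images comes from that of inverse images, by uniqueness of left
   adjoints. *)
- by move=> X A; apply: fle_yoneda => D; rewrite cdirP cinvP cinv_id.
- move=> X Y Z g f A; apply: fle_yoneda => D.
  by rewrite !cdirP !cinvP cdirP cinvP cinv_comp.
Defined.

End Form.

(** * Kernels, images, and the identities for composites of direct and inverse images *)

Section Noetherian.
Variable L : rankedSet.
Implicit Types X Y Z : augCat L.
Local Notation F := (markedPrunings L).
Local Notation O := (clusters_orean L).

Lemma fle_Ker X Y (f : hom X Y) (A : fib F X) : fle A (Ker O f) <->
  (forall a, colset A a -> aleaf (afun f a)) /\ (forall a, ~ markset A a).
Proof. by rewrite fleP !(colsetE, marksetE). Qed.

Lemma colset_Ker X Y (f : hom X Y) a : colset (Ker O f) a <-> aleaf (afun f a).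
Proof. by rewrite colsetE colsetE. Qed.

Lemma markset_Ker X Y (f : hom X Y) a : ~ markset (Ker O f) a.
Proof. by rewrite marksetE marksetE. Qed.

Lemma colset_inv X Y (f : hom X Y) (B : fib F Y) : colset (inv O f B) = fun a => colset B (afun f a).
Proof. exact: colsetE. Qed.

Lemma markset_inv X Y (f : hom X Y) (B : fib F Y) : markset (inv O f B) = fun a => markset B (afun f a).
Proof. exact: marksetE. Qed.

Lemma cmp_dir X Y (f : hom X Y) (A : fib F X) : cmp f A (dir O f A).
Proof. apply: (proj1 (dir_le O f A _)); exact: fle_refl. Qed.

Lemma cmp_inv X Y (f : hom X Y) (B : fib F Y) : cmp f (inv O f B) B.
Proof. apply: (proj2 (le_inv O f _ B)); exact: fle_refl. Qed.

(** The candidate for the image cluster. By [afun_up] its mark is the image of [f] on positions,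
    empty if [X] is 0. *)
Lemma marking_image X Y (f : hom X Y) :
  marking (fun y => aleaf y \/ exists a, apre (afun f a) y)
          (fun y => exists a, apre (afun f a) y).
Proof.
split=> [y|y z yz [ly|[a ay]]|y|y z yz [a ay]|y z yz [ly|//] [a az]|y z [a ay] [b bz]].
- by left.
- by left; rewrite (apre_leaf yz ly).
- by right; exists a; apply: apre_trans ay yz.
- by right.
- by exists a; apply: apre_trans ay yz.
- by exists a; rewrite -(apre_leaf yz ly).
have [r Hr] := apos_root a; exists (afun f r).
  by exists r; exact: apre_refl.
split; [apply: apre_trans ay|apply: apre_trans bz]; exact/afun_mono/Hr.
Qed.

Lemma fle_Im X Y (f : hom X Y) (B : fib F Y) :
  fle (Im O f) B <-> forall a, markset B (afun f a).
Proof.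
rewrite /Im cdirP cmpP; split=> [[_ H] a|H]; first by apply: H; rewrite marksetE.
by split=> a _ //; exact: (marking_sub (marking_cluster B)).
Qed.

Lemma Im_image X Y (f : hom X Y) : Im O f = cluster_with (marking_image f).
Proof.
have imM a : markset (Im O f) (afun f a) by move: a; apply/fle_Im; exact: fle_refl.
apply: fle_anti.
  by apply/fle_Im => a; rewrite marksetE; exists a; exact: apre_refl.
have v := marking_cluster (Im O f).
apply/fleP; rewrite colsetE marksetE; split=> [y [ly|[a ay]]|y [a ay]].
- exact: (marking_leaf v).
- exact: (marking_up v) ay (marking_sub v (imM a)).
- exact: (marking_mark_up v) ay (imM a).
Qed.

(** Above the kernel, direct images may be formed on positions: distinct positions identified by [f]
    share a prefix in the kernel, so [A] is saturated. *)
Lemma marking_direct_image X Y (f : hom X Y) (A : cluster X) : fle (Ker O f) A ->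
  marking (fun y => aleaf y \/ exists2 a, colset A a & afun f a = y)
          (fun y => exists2 a, markset A a & afun f a = y).
Proof.
move=> /fleP [KA _]; have {}KA a : aleaf (afun f a) -> colset A a.
  by move=> H; apply: KA; rewrite colsetE colsetE.
have v := marking_cluster A.
(* Where [f] fails to reflect the order, both images are the same leaf, and [b] is in the kernel. *)
have preE a b : apre (afun f a) (afun f b) -> colset A a -> colset A b.
  move=> ab; have [ab' Ea|la Ea] := afun_pre ab; first exact: (marking_up v) ab' Ea.
  by apply: KA; rewrite (apre_leaf ab la).
have eqM a b : afun f a = afun f b -> markset A a -> markset A b.
  move=> e; have [->//|[j lj [ja jb]]] := afun_eq e => Ma.
  exact: (marking_mark_up v) jb (marking_mark_down v ja (KA _ lj) Ma).
split.
- by left.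
- move=> y z yz [ly|[a Ea ay]]; first by left; rewrite (apre_leaf yz ly).
  subst y; have [b bz] := afun_up yz; subst z.
  by right; exists b => //; exact: preE Ea.
- by move=> y [a Ma <-]; right; exists a => //; exact: (marking_sub v).
- move=> y z yz [a Ma ay]; subst y; have [b bz] := afun_up yz; subst z.
  exists b => //; have [ab|la] := afun_pre yz; first exact: (marking_mark_up v) ab Ma.
  by apply: eqM Ma; rewrite (apre_leaf yz la).
- move=> y z yz [ly|[a Ea ay]] [b Mb bz].
    by exists b => //; rewrite bz (apre_leaf yz ly).
  subst y z; have [ab|la] := afun_pre yz.
    by exists a => //; exact: (marking_mark_down v) ab Ea Mb.
  by exists b => //; rewrite (apre_leaf yz la).
- move=> y z [a Ma <-] [b Mb <-]; have [d Md [da db]] := marking_common_prefix v Ma Mb.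
  by exists (afun f d); [exists d|split; exact: afun_mono].
Qed.

(** For the nontrivial inequality, the join [J] contains the kernel, so [marking_direct_image] gives
    a cluster [B] that bounds the direct image of [A] and whose preimage lies in [J]. *)
Lemma inv_dir X Y (f : hom X Y) (A : fib F X) : inv O f (dir O f A) = join O A (Ker O f).
Proof.
have [AJ KJ] : fle A (join O A (Ker O f)) /\ fle (Ker O f) (join O A (Ker O f)).
  by apply/(join_le O); exact: fle_refl.
apply: fle_anti; last first.
  apply/(join_le O); split; first by apply: (proj1 (le_inv O f A _)); exact: cmp_dir.
  apply/fleP; split=> a; last by move/markset_Ker.
  move/colset_Ker=> la; rewrite colsetE; exact: (marking_leaf (marking_cluster (dir O f A))).
set J := join O _ _ in AJ KJ *.
have v := marking_cluster J; pose B := cluster_with (marking_direct_image KJ).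
have KE a : aleaf (afun f a) -> colset J a.
  by have /fleP [H _] := KJ => la; apply: H; apply/colset_Ker.
have preim : forall a, (colset B (afun f a) -> colset J a) /\ (markset B (afun f a) -> markset J a).
  move=> a; rewrite colsetE marksetE; split.
    case=> [/KE//|[b Eb e]].
    have [<-//|[j lj [_ ja]]] := afun_eq e; exact: (marking_up v) ja (KE _ lj).
  case=> b Mb e; have [<-//|[j lj [jb ja]]] := afun_eq e.
  exact: (marking_mark_up v) ja (marking_mark_down v jb (KE _ lj) Mb).
have AB : fle (dir O f A) B.
  apply/cdirP/cmpP; move/fleP: AJ => [AE AM]; rewrite colsetE marksetE.
  by split=> a; [move/AE => H; right|move/AM => H]; exists a.
move/fleP: AB => [BE BM]; apply/fleP; rewrite colset_inv markset_inv.
by split=> a; [move/BE; case: (preim a)|move/BM; case: (preim a)].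
Qed.

(** A collapsed or marked position of the meet is a leaf or, by [afun_up], some [afun f b] with [b]
    in the inverse image of [B]; the unit puts it in the direct image. *)
Lemma dir_inv X Y (f : hom X Y) (B : fib F Y) : dir O f (inv O f B) = meet O B (Im O f).
Proof.
have unit := cmp_dir f (inv O f B).
apply: fle_anti.
  apply/cmeetP; split; first by apply/(dir_le O); exact: cmp_inv.
  apply/cdirP/cmpP; rewrite Im_image !(colsetE, marksetE).
  by split=> a _; [right|]; exists a; exact: apre_refl.
set D := dir O f _ in unit *; have v := marking_cluster D.
have [MB MI] : fle (meet O B (Im O f)) B /\ fle (meet O B (Im O f)) (Im O f).
  by apply/(le_meet O); exact: fle_refl.
set M := meet O B _ in MB MI *.
move/cmpP: unit; rewrite colset_inv markset_inv => -[UE UM].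
move: MB MI => /fleP [BE BM] /fleP; rewrite Im_image colsetE marksetE => -[IE IM].
apply/fleP; split=> y Hy.
  have [ly|[a ay]] := IE y Hy; first exact: (marking_leaf v).
  by have [b e] := afun_up ay; subst y; apply: UE; exact: BE.
by have [a ay] := IM y Hy; have [b e] := afun_up ay; subst y; apply: UM; exact: BM.
Qed.

(** * Universal properties of the classes E and M *)

Lemma univ_quotient_classE X Q (A : fib F X) (q : hom X Q) : classE q ->
  (forall a, colset A a <-> aleaf (afun q a)) -> (forall a, ~ markset A a) ->
  univ_quotient_of O A q.
Proof.
move=> qE HE HM; split; first by apply/fle_Ker; split=> // a /HE.
move=> Y f /fle_Ker [fE _]; have [|h Hh] := classE_factor qE (f := f).
  by move=> a /HE /fE.
by exists h; split=> // g Hg; apply: classE_epi qE _; rewrite Hg.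
Qed.

Lemma univ_embedding_classM W Y (B : fib F Y) (m : hom W Y) : classM m ->
  (forall y, markset B y <-> exists w, apre (afun m w) y) -> univ_embedding_of O B m.
Proof.
move=> mM HM; split.
  by apply/fle_Im => w; apply/HM; exists w; exact: apre_refl.
move=> X f /fle_Im fM; have [|g Hg] := classM_factor mM (f := f).
  by move=> a; apply/HM.
by exists g; split=> // g' Hg'; apply: classM_mono mM _; rewrite Hg'.
Qed.

(** The composite has the kernel of [q] because [m] reflects leaves, and the image of [m] because
    [q] is surjective on positions. *)
Lemma univ_factorization X Y (f : hom X Y) : exists Q (q : hom X Q) (m : hom Q Y),
  [/\ f = comp m q, univ_quotient_of O (Ker O f) q & univ_embedding_of O (Im O f) m].
Proof.
have [Q [q [m [-> qE mM]]]] := image_factorization f; exists Q, q, m; split=> //.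
  apply: univ_quotient_classE => // a; last exact: markset_Ker.
  rewrite colset_Ker afun_comp /=; split; first exact: classM_leaf.
  exact: afun_leaf.
apply: univ_embedding_classM => // y; rewrite Im_image marksetE; split=> -[a].
  by rewrite afun_comp; exists (afun q a).
have [b <-] := classE_surj qE a; exists b; by rewrite afun_comp.
Qed.

(** * Normal and conormal clusters *)

Lemma normalP X (A : fib F X) : normal O A <-> forall a, ~ markset A a.
Proof.
split=> [[Y [f ->]]|H]; first exact: markset_Ker.
(* An unmarked cluster is the kernel of its own quotient map. *)
exists (cobj (rep A)), (cquo (rep A)); apply: cluster_eqP => a; first by rewrite colset_Ker.
by split=> [/H//|/markset_Ker].
Qed.

(** A mark is empty, matching the map from 0, or the cone over its least element [p], matching the
    occurrence at [p]. *)
Lemma embedding_of_mark X (A : fib F X) : exists W (m : hom W X),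
  classM m /\ forall y, markset A y <-> exists w, apre (afun m w) y.
Proof.
have v := marking_cluster A.
have [[a Ma]|nM] := pselect (exists a, markset A a); last first.
  exists zero, (from0 X); split; first exact: classM_from0.
  by move=> y; split=> [My|[[]]]; case: nM; exists y.
have [p Mp Hp] := marking_min v Ma.
case: X A v a p Ma Mp Hp => [X|] A v a p Ma Mp Hp; last by case: a.
exists (Some (sub p)), (augOccurrence p); split.
  rewrite -[augOccurrence p]comp_idr; apply: classM_occurrence; exact: is_iso_id.
move=> y; split=> [My|[w]].
  exists (root (sub p)); rewrite afun_occurrence pcat_root; exact: Hp.
rewrite afun_occurrence => H; apply: (marking_mark_up v) Mp; apply: prefix_trans H.
by exists w.
Qed.

Lemma conormalP X (A : fib F X) :
  conormal O A <-> forall a, colset A a -> aleaf a \/ markset A a.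
Proof.
split=> [[W [f ->]] a|H]; first by rewrite Im_image colsetE marksetE.
have v := marking_cluster A; have [W [m [_ mP]]] := embedding_of_mark A.
exists W, m; rewrite Im_image; apply: cluster_eqP => a; rewrite ?colsetE ?marksetE.
  split=> [/H [la|/mP]|[/(marking_leaf v)//|/mP/(marking_sub v)//]]; by [left|right].
exact: mP.
Qed.

(** The union of the collapsed sets, with no mark, is already an upper bound. *)
Lemma normal_join X (A B : fib F X) :
  normal O A -> normal O B -> normal O (join O A B).
Proof.
move=> /normalP HA /normalP HB; apply/normalP => a.
have v : marking (fun a => colset A a \/ colset B a) (fun=> False).
  have vA := marking_cluster A; have vB := marking_cluster B.
  split=> // [b lb|b c bc [|]]; first by left; exact: (marking_leaf vA).
    by left; exact: (marking_up vA) bc _.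
  by right; exact: (marking_up vB) bc _.
have /fleP [_ H] : fle (join O A B) (cluster_with v).
  apply/cjoinP; split; apply/fleP; rewrite colsetE marksetE; split=> // b; by [left|right].
by move/H; rewrite marksetE.
Qed.

Lemma conormal_meet X (A B : fib F X) :
  conormal O A -> conormal O B -> conormal O (meet O A B).
Proof.
move=> /conormalP HA /conormalP HB; apply/conormalP => a.
rewrite [colset _]colsetE [markset _]marksetE => H.
have [|MA] := HA a (H A (or_introl erefl)); first by left.
have [|MB] := HB a (H B (or_intror erefl)); first by left.
by right=> D [->|->].
Qed.

(** * Exact join decomposition *)

Lemma marking_unmark X (A : cluster X) : marking (colset A) (fun=> False).
Proof.
have v := marking_cluster A; split=> // [a|a b]; [exact: (marking_leaf v)|exact: (marking_up v)].
Qed.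

Lemma marking_only_mark X (A : cluster X) :
  marking (fun a => aleaf a \/ markset A a) (markset A).
Proof.
have v := marking_cluster A.
split=> [a|a b ab [la|Ma]|a|a b|a b ab [la|//]|a b]; try by [left|right].
- by left; rewrite (apre_leaf ab la).
- by right; exact: (marking_mark_up v) ab Ma.
- exact: (marking_mark_up v).
- by rewrite (apre_leaf ab la).
- exact: (marking_common_prefix v).
Qed.

Lemma decomposition : exact_join_decomposition O.
Proof.
(* [n] forgets the mark; [c] keeps the mark and collapses only marked positions and leaves. *)
exists (fun X A => cluster_with (marking_unmark A)), (fun X A => cluster_with (marking_only_mark A)).
split; [|split; [|split; [|split]]].
- move=> X A; split; first by apply/normalP => a; rewrite marksetE.
    by apply/fleP; rewrite colsetE marksetE.
  move=> N /normalP NM /fleP [NE _]; apply/fleP; rewrite colsetE marksetE.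
  by split=> // a /NM.
- move=> X A; have v := marking_cluster A; split.
  + by apply/conormalP => a; rewrite colsetE marksetE.
  + apply/fleP; rewrite colsetE marksetE; split=> // a [|].
      exact: (marking_leaf v).
    exact: (marking_sub v).
  move=> N /conormalP NC /fleP [_ NM]; apply/fleP; rewrite colsetE marksetE; split=> // a.
  by case/NC=> [|/NM]; [left|right].
- move=> X A; have v := marking_cluster A; apply: fle_yoneda => D.
  rewrite [fle (join _ _ _) _]cjoinP !fleP !(colsetE, marksetE).
  split=> [[HE HM]|[[_ HM] [HE _]] //].
  split; split=> // a [|/HM]; first exact: (marking_leaf (marking_cluster D)).
  exact: (marking_sub (marking_cluster D)).
- by move=> X Y f B; apply: cluster_eqP => a; rewrite !(colsetE, marksetE).
move=> X Y f; apply: fle_anti.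
  apply/cdirP/cmpP; rewrite Im_image !colsetE !marksetE; split=> // a _.
  by rewrite colsetE; right; exists a; exact: apre_refl.
set D := dir O f _; have v := marking_cluster D.
(* The unmarked top cluster collapses every position, so [D] collapses every [afun f a] and its
   extensions. *)
have /cmpP [DE _] : cmp f (cluster_with (marking_unmark (top O X)) : fib F X) D by exact: cmp_dir.
apply/fleP; rewrite Im_image !colsetE !marksetE; split=> // y.
rewrite colsetE => -[|[a ay]]; first exact: (marking_leaf v).
by apply: (marking_up v) ay _; apply: DE; rewrite !colsetE.
Qed.

(** * Identification of all universal quotients and embeddings *)

Lemma univ_quotientP X Y (f : hom X Y) : univ_quotient O f <-> classE f.
Proof.
split=> [[A [/fle_Ker [fE fM] fU]]|fE]; last first.
  exists (Ker O f); apply: univ_quotient_classE => // a; [exact: colset_Ker|exact: markset_Ker].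
(* Lying below a kernel, [A] is unmarked, so the quotient map of its representative is also a
   universal quotient of [A], and differs from [f] by an isomorphism. *)
have qE := cquoE (rep A).
have [qK qU] : univ_quotient_of O A (cquo (rep A)) by exact: univ_quotient_classE.
have [|h [Hh _]] := qU _ f; first by apply/fle_Ker.
have [h' [Hh' _]] := fU _ _ qK.
rewrite -Hh; apply: classE_isol => //; exists h'; split.
  by apply: classE_epi qE _; rewrite -comp_assoc Hh Hh' comp_idl.
have [g [_ gU]] : exists! g, comp g f = f by apply: fU; apply/fle_Ker.
rewrite -(gU (comp h h')); first by apply: gU; rewrite comp_idl.
by rewrite -comp_assoc Hh'.
Qed.

Lemma univ_embeddingP X Y (f : hom X Y) : univ_embedding O f <-> classM f.
Proof.
split=> [[B [fI fU]]|fM]; last first.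
  exists (Im O f); apply: univ_embedding_classM => // y.
  by rewrite Im_image marksetE.
(* The embedding cutting out the mark of [B] has the same universal property as [f]. *)
have [W [m [mM mP]]] := embedding_of_mark B.
have [mI mU] : univ_embedding_of O B m by exact: univ_embedding_classM.
have [h [Hh _]] := mU _ _ fI; have [h' [Hh' _]] := fU _ _ mI.
rewrite -Hh; apply: classM_isor => //; exists h'; split.
  have [g [_ gU]] := fU _ _ fI.
  rewrite -(gU (comp h' h)); first by apply: gU; rewrite comp_idr.
  by rewrite comp_assoc Hh'.
by apply: classM_mono mM _; rewrite comp_assoc Hh Hh' comp_idr.
Qed.

End Noetherian.

Theorem theorem4p7 (L : rankedSet) :
  is_form (markedPrunings L) /\
  exists O : orean (markedPrunings L),
    [/\ noetherian O,
        exact_join_decomposition O,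
        forall (X Y : augCat L) (f : hom X Y), univ_quotient O f <-> classE f
      & forall (X Y : augCat L) (f : hom X Y), univ_embedding O f <-> classM f].
Proof.
split; first exact: markedPrunings_form.
exists (clusters_orean L); split.
- split; [exact: inv_dir|exact: dir_inv|exact: univ_factorization|exact: normal_join|].
  exact: conormal_meet.
- exact: decomposition.
- exact: univ_quotientP.
- exact: univ_embeddingP.
Qed.
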